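(* Let $\psi,f:\Sigma\to\mathbb{R}$ be Hölder continuous functions and fix $K>D_\psi$. (1) If $0\in(\underline{\psi},\overline{\psi})$, then there exists a unique number $t(f)\in\mathbb{R}$ with $\int\psi\,d\mu_{t(f)\psi+f}=0$, and for this number $$\mathcal{P}(f,\psi,K)=\mathfrak{P}(t(f)\psi+f)=\min_{s\in\mathbb{R}}\mathfrak{P}(s\psi+f).$$ (2) If $\psi$ is constant on one-cylinder sets (allowing also $0\notin(\underline{\psi},\overline{\psi})$), then $$\mathcal{P}(f,\psi,K)=\inf_{s\in\mathbb{R}}\mathfrak{P}(s\psi+f),$$ and the value of the fibre-induced pressure is finite if and only if $0\in[\underline{\psi},\overline{\psi}]$. If moreover $0\in\{\underline{\psi},\overline{\psi}\}$, then with $I_0=\{i\in I:\psi(i,\ldots)=0\}$ we have $$\mathcal{P}(f,\psi,K)=\mathfrak{P}(f,I_0).$$ (3) If $0\in(\underline{\psi},\overline{\psi})$, or if $\psi$ is constant on one-cylinder sets and $0\in[\underline{\psi},\overline{\psi}]$, then $$\sum_{\omega\in\mathcal{C}(K)}e^{S_\omega f-|\omega|\,\mathcal{P}(f,\psi,K)}=\infty .$$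
   Context: Let $I$ be a finite set, $\Sigma=I^{\mathbb{N}}$ with left shift $\sigma$ and metric $d(\omega,\tau)=\exp(-\max\{k\ge0:\omega_1=\tau_1,\dots,\omega_k=\tau_k\})$. $I^\star$ is the set of finite words over $I$, $|\omega|$ the length of $\omega$, $[\omega]=\{x\in\Sigma:x|_{|\omega|}=\omega\}$. For $f:\Sigma\to\mathbb{R}$, $S_nf=\sum_{k=0}^{n-1}f\circ\sigma^k$ and $S_\omega f=\sup_{x\in[\omega]}S_{|\omega|}f(x)$ for $\omega\in I^\star$. For Hölder continuous $f$, $D_f$ denotes the distortion constant, i.e. a constant with $\sup_{x,y\in[\omega]}|S_nf(x)-S_nf(y)|\le D_f$ for all $n\in\mathbb{N}$, $\omega\in I^n$ (one takes $D_f=0$ if $f$ is constant on one-cylinder sets). Classical pressure: for non-empty $J\subset I$ and continuous $f$, $\mathfrak{P}(f,J)=\lim_{n\to\infty}\frac1n\log\sum_{\omega\in J^n}\exp(S_\omega f)$ and $\mathfrak{P}(f)=\mathfrak{P}(f,I)$. For Hölder continuous $f$, $\mu_f$ is the Gibbs measure: the unique $\sigma$-invariant Borel probability measure on $\Sigma$ for which there is $c\ge1$ with $c^{-1}\le\mu_f([\omega])/\exp(S_nf(x)-n\mathfrak{P}(f))\le c$ for all $n\in\mathbb{N}$, $\omega\in I^n$, $x\in[\omega]$. $\underline{\psi}=\inf_{\omega\in\Sigma}\liminf_{n\to\infty}S_n\psi(\omega)/n$ and $\overline{\psi}=\sup_{\omega\in\Sigma}\limsup_{n\to\infty}S_n\psi(\omega)/n$.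 For $K>0$: $\mathcal{C}_n(K)=\{\omega\in I^n:|S_\omega\psi|\le K\}$, $\mathcal{C}(K)=\bigcup_{n\in\mathbb{N}}\mathcal{C}_n(K)$, and $$\mathcal{P}(f,\psi,K)=\limsup_{n\to\infty}\frac1n\log\sum_{\omega\in\mathcal{C}_n(K)}e^{S_\omega f}\in[-\infty,\infty),\qquad \mathcal{P}(f,\psi)=\lim_{K\to\infty}\mathcal{P}(f,\psi,K)$$ ($\log 0=-\infty$). $\mathcal{P}(f,\psi)$ is called the fibre-induced pressure of $f$ with respect to $\psi$. *)

(* Defs.v *)
From HB Require Import structures.
From mathcomp Require Import all_boot all_order all_algebra.
From mathcomp Require Import all_classical all_reals all_analysis.

Set Implicit Arguments.
Unset Strict Implicit.
Unset Printing Implicit Defensive.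

Import Order.TTheory GRing.Theory Num.Theory.
Import numFieldNormedType.Exports.

Local Open Scope classical_set_scope.
Local Open Scope ring_scope.

(* One-sided sequences over the alphabet I, with coordinates numbered from 0
   instead of 1.  The parameters R and i0 are phantoms: the metric takes its
   values in R, and i0 witnesses that I is not empty, which makes the space
   pointed, as [measurableType] requires. *)
Definition shift_space (R : realType) (I : finType) (i0 : I) : Type := nat -> I.
Arguments shift_space R {I} i0.

Section metric.
Context {R : realType} {I : finType} {i0 : I}.
Implicit Types x y z : shift_space R i0.

Definition agree x y : set nat :=
  [set k | forall j, (j < k)%N -> x j = y j].

Definition common_length x y : \bar R :=
  ereal_sup [set (k%:R)%:E | k in agree x y].

(* exp(- max {k | x and y share their first k letters}); the supremum is
   infinite, hence the distance is zero, when x = y. *)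
Definition seq_dist x y : R := fine (expeR (- common_length x y)%E).

Lemma common_length_ge0 x y : (0 <= common_length x y)%E.
Proof. by apply: ereal_sup_ubound; exists 0%N. Qed.

Lemma seq_distE x y :
  ((seq_dist x y)%:E = expeR (- common_length x y))%E.
Proof.
rewrite /seq_dist fineK//; case: (common_length x y) (common_length_ge0 x y) => //=.
Qed.

Lemma seq_dist_ge0 x y : 0 <= seq_dist x y.
Proof. by rewrite -lee_fin seq_distE expeR_ge0. Qed.

Lemma common_lengthxx x : common_length x x = +oo%E.
Proof.
apply/eqyP => r r0.
apply: le_trans (_ : ((Num.bound r)%:R%:E <= _)%E).
  by rewrite lee_fin ltW// archi_boundP// ltW.
by apply: ereal_sup_ubound; exists (Num.bound r).
Qed.

Lemma seq_distxx x : seq_dist x x = 0.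
Proof. by rewrite /seq_dist common_lengthxx. Qed.

Lemma seq_dist_positivity x y : seq_dist x y = 0 -> x = y.
Proof.
move=> d0; apply/funext => j.
have : common_length x y = +oo%E.
  have /eqP : expeR (- common_length x y)%E = 0%E by rewrite -seq_distE d0.
  by rewrite expeR_eq0; case: (common_length x y).
move=> cy.
have : (j%:R%:E < common_length x y)%E by rewrite cy ltry.
move=> /ereal_sup_gt[_ [k kxy <-]]; rewrite lte_fin ltr_nat => jk.
exact: kxy.
Qed.

Lemma seq_dist_sym x y : seq_dist x y = seq_dist y x.
Proof.
rewrite /seq_dist /common_length; congr (fine (expeR (- ereal_sup _)%E)).
by rewrite (_ : agree x y = agree y x)//; apply/seteqP; split => k kxy j jk;
  rewrite kxy.
Qed.

Lemma seq_dist_triangle y x z : seq_dist x z <= seq_dist x y + seq_dist y z.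
Proof.
suff : (Order.min (common_length x y) (common_length y z)
        <= common_length x z)%E.
  rewrite ge_min => /orP[] le.
    apply: (@le_trans _ _ (seq_dist x y)); last by rewrite lerDl seq_dist_ge0.
    by rewrite -lee_fin !seq_distE lee_expeR leeN2.
  apply: (@le_trans _ _ (seq_dist y z)); last by rewrite lerDr seq_dist_ge0.
  by rewrite -lee_fin !seq_distE lee_expeR leeN2.
rewrite leNgt; apply/negP; rewrite lt_min => /andP[].
move=> /ereal_sup_gt[_ [k kxy <-]] ck /ereal_sup_gt[_ [l lyz <-]] cl.
suff : ((minn k l)%:R%:E <= common_length x z)%E.
  by rewrite leNgt; case: (leqP k l) => _; rewrite ?ck ?cl.
apply: ereal_sup_ubound; exists (minn k l) => // j.
by rewrite leq_min => /andP[jk jl]; rewrite kxy// lyz.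
Qed.

End metric.

HB.instance Definition _ (R : realType) (I : finType) (i0 : I) :=
  Choice.copy (shift_space R i0) (nat -> I).
HB.instance Definition _ (R : realType) (I : finType) (i0 : I) :=
  isPointed.Build (shift_space R i0) (fun=> i0).
HB.instance Definition _ (R : realType) (I : finType) (i0 : I) :=
  @isMetric.Build R (shift_space R i0) (@seq_dist R I i0) (@seq_distxx R I i0)
    (@seq_dist_positivity R I i0) (@seq_dist_sym R I i0)
    (@seq_dist_triangle R I i0).

Definition borel_shift_space (R : realType) (I : finType) (i0 : I) :=
  g_sigma_algebraType (@open (shift_space R i0)).
Arguments borel_shift_space R {I} i0.

Section thermodynamics.
Context {R : realType} {I : finType} {i0 : I}.
Local Notation Sigma := (shift_space R i0).
Implicit Types (f psi : Sigma -> R) (w : seq I) (x y : Sigma).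

Definition shift x : Sigma := fun n => x n.+1.

Definition cylinder w : set Sigma := [set x | mkseq x (size w) = w].

Definition holder_continuous f : Prop :=
  exists2 a : R, 0 < a &
  exists C : R, forall x y, `|f x - f y| <= C * (mdist x y `^ a).

Definition birkhoff f (n : nat) x : R := \sum_(k < n) f (iter k shift x).

Definition word_sum f w : R := sup [set birkhoff f (size w) x | x in cylinder w].

Definition distortion_constant f (D : R) : Prop :=
  forall w x y, cylinder w x -> cylinder w y ->
  `|birkhoff f (size w) x - birkhoff f (size w) y| <= D.

Definition constant_on_one_cylinders f : Prop :=
  forall x y, x 0%N = y 0%N -> f x = f y.

Definition pressure_on f (J : {set I}) : R :=
  limn (fun n => n%:R^-1 *
    ln (\sum_(w : n.-tuple I | all (mem J) w) expR (word_sum f w))).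

Definition pressure f : R := pressure_on f [set: I]%SET.

Definition shift_invariant (mu : probability (borel_shift_space R i0) R) : Prop :=
  forall A : set (borel_shift_space R i0), measurable A ->
    mu (shift @^-1` A) = mu A.

Definition gibbs_property f (mu : probability (borel_shift_space R i0) R) : Prop :=
  exists2 c : R, 1 <= c & forall w x, cylinder w x ->
  (c^-1%:E <=
   mu (cylinder w) *
     (expR (birkhoff f (size w) x - (size w)%:R * pressure f))^-1%:E
   <= c%:E)%E.

(* Uniqueness is up to equality on Borel sets, since the values of a
   [measure] outside the measurable sets are unconstrained. *)
Definition is_gibbs_measure f (mu : probability (borel_shift_space R i0) R) : Prop :=
  [/\ shift_invariant mu, gibbs_property f mu &
      forall nu : probability (borel_shift_space R i0) R,
        shift_invariant nu -> gibbs_property f nu ->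
        forall A, measurable A -> nu A = mu A].

Definition lower_mean psi : \bar R :=
  ereal_inf (range (fun x => limn_einf (fun n => (birkhoff psi n x / n%:R)%:E))).

Definition upper_mean psi : \bar R :=
  ereal_sup (range (fun x => limn_esup (fun n => (birkhoff psi n x / n%:R)%:E))).

Definition fibre_words psi (K : R) : set (seq I) :=
  [set w | (0 < size w)%N /\ `|word_sum psi w| <= K].

Definition fibre_pressure_at f psi (K : R) : \bar R :=
  limn_esup (fun n => (n%:R^-1)%:E *
    lne (\sum_(w : n.-tuple I | `|word_sum psi w| <= K)
           expR (word_sum f w))%:E)%E.

Definition fibre_pressure f psi : \bar R :=
  lim (fibre_pressure_at f psi K @[K --> +oo%R]).

Definition zero_letters psi : {set I} :=
  [set i : I | `[< forall x, x 0%N = i -> psi x = 0 >]]%SET.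

End thermodynamics.

(* Main.v *)
(* Everything is done on words.  The word sums A = S psi and B = S f are
   quasi-additive, so the pressure P(s) of s psi + f is read off the partition
   functions up to a bounded error, and a Gibbs measure is a shift-invariant
   content m on words with m(w) = exp(s A(w) + B(w) - |w| P(s)) up to a constant.

   Such contents exist by compactness.  They are quasi-Bernoulli, so that bounded
   relative entropy of another invariant content with respect to m forces a uniform
   lower bound in terms of m; this gives uniqueness, and it shows that two Gibbs
   contents of psi-mean zero with different parameters make the sums of psi bounded,
   which 0 in (lower mean, upper mean) excludes.

   By Jensen's inequality the psi-mean of a Gibbs content at s is a subgradient of P
   at s.  P is coercive, hence has a minimizer t; uniqueness of the Gibbs content
   identifies the one-sided limits at t, so that P has derivative 0 there.  The bound
   from above P(f, psi, K) <= P(s) is immediate.  For the bound from below,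
   differentiability yields a weak law of large numbers for S psi under the Gibbs
   content at t, which makes the walk S psi recurrent: the measures of the sets
   C_n(K) have infinite sum.  This is the divergence in (3), and it excludes an
   exponential growth rate smaller than P(t).

   When psi is constant on one-cylinders and has extremal mean 0, letting s tend to
   infinity in the appropriate direction in finite partition functions
   leaves only the words over I_0. *)
Require Import Defs.
From HB Require Import structures.
From mathcomp Require Import all_boot all_order all_algebra.
From mathcomp Require Import all_classical all_reals all_analysis.
From mathcomp Require Import ring lra.

Set Implicit Arguments.
Unset Strict Implicit.
Unset Printing Implicit Defensive.

Import Order.TTheory GRing.Theory Num.Theory.
Import numFieldNormedType.Exports.

Local Open Scope classical_set_scope.
Local Open Scope ring_scope.

(** * Sums over words and quasi-additive sequences *)

(** All errors are bounded independently of the word length, so every step is an inequality at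
    length n whose constant disappears on division by n. If Gibbs contents at s and t both have
    psi-mean 0, then P(s) = P(t) and their log-density is (s - t) S psi up to a constant; its mean
    is bounded, which is the bounded relative entropy. Uniqueness at t plays the part of ergodicity:
    it yields the derivative of P at t, and an exponential Markov inequality turns this into the law
    of large numbers.

    The obstacle in the bound from below is to pass from |S psi| <= e n to |S psi| <= K for every K
    > D. Concatenation changes S psi by an amount in [-D, 0], so between two visits to a window of
    length K - D the walk reads a word with |S psi| <= K. If the sets C_n(K) had total measure U,
    each window would be visited at most a constant multiple of U times on average, and [-e n, e n]
    would be occupied for a time of order e n + 1; the law of large numbers demands about n / 2,
    which is absurd for small e. *)

Section word_sums.
Context {R : realType} {I : finType}.
Implicit Types (F G : seq I -> R) (u v w : seq I) (n k : nat).

Definition wsum n F : R := \sum_(w : n.-tuple I) F w.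

Lemma eq_wsum n F G : (forall w, size w = n -> F w = G w) -> wsum n F = wsum n G.
Proof. by move=> FG; apply: eq_bigr => w _; rewrite FG// size_tuple. Qed.

Lemma ler_wsum n F G : (forall w, size w = n -> F w <= G w) ->
  wsum n F <= wsum n G.
Proof. by move=> FG; apply: ler_sum => w _; rewrite FG// size_tuple. Qed.

Lemma wsum_ge0 n F : (forall w, size w = n -> 0 <= F w) -> 0 <= wsum n F.
Proof. by move=> F0; apply: sumr_ge0 => w _; rewrite F0// size_tuple. Qed.

Lemma wsumMl n c F : wsum n (fun w => c * F w) = c * wsum n F.
Proof. by rewrite /wsum mulr_sumr. Qed.

Lemma wsumMr n c F : wsum n (fun w => F w * c) = wsum n F * c.
Proof. by rewrite /wsum mulr_suml. Qed.

Lemma wsum_add n F G : wsum n (fun w => F w + G w) = wsum n F + wsum n G.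
Proof. by rewrite /wsum big_split. Qed.

Lemma wsum_sub n F G : wsum n (fun w => F w - G w) = wsum n F - wsum n G.
Proof. by rewrite /wsum big_split/= sumrN. Qed.

Lemma wsum_exchange n k (H : seq I -> seq I -> R) :
  wsum n (fun u => wsum k (H u)) = wsum k (fun v => wsum n (H^~ v)).
Proof. by rewrite /wsum exchange_big. Qed.

Lemma wsum_bigr n (J : finType) (P : pred J) (H : seq I -> J -> R) :
  wsum n (fun u => \sum_(j | P j) H u j) = \sum_(j | P j) wsum n (H^~ j).
Proof. by rewrite /wsum exchange_big. Qed.

Lemma wsum0 F : wsum 0 F = F [::].
Proof.
rewrite /wsum (bigD1 [tuple])//= big1 ?addr0// => w.
by case/eqP; apply: tuple0.
Qed.

Lemma wsumS n F : wsum n.+1 F = \sum_i wsum n (fun v => F (i :: v)).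
Proof.
rewrite /wsum pair_big/=.
rewrite (reindex (fun p : I * n.-tuple I => [tuple of p.1 :: p.2]))//=.
exists (fun w : n.+1.-tuple I => (thead w, [tuple of behead w])) => -[].
  by move=> i v _ /=; congr (_, _); apply: val_inj.
by move=> s hs _; rewrite /= [RHS]tuple_eta.
Qed.

Lemma wsum1 F : wsum 1 F = \sum_i F [:: i].
Proof. by rewrite wsumS; apply: eq_bigr => i _; rewrite wsum0. Qed.

Lemma wsumD n k F :
  wsum (n + k) F = wsum n (fun u => wsum k (fun v => F (u ++ v))).
Proof.
elim: n F => [|n IH] F; first by rewrite wsum0.
by rewrite addSn !wsumS; apply: eq_bigr => i _; rewrite IH.
Qed.

Lemma wsumSr n F : wsum n.+1 F = wsum n (fun u => \sum_i F (rcons u i)).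
Proof.
rewrite -addn1 wsumD; apply: eq_wsum => u _; rewrite wsum1.
by apply: eq_bigr => i _; rewrite cats1.
Qed.

Lemma ler_wsum_term n F w : (forall w, size w = n -> 0 <= F w) -> size w = n ->
  F w <= wsum n F.
Proof.
move=> F0 /eqP wn; rewrite /wsum (bigD1 (Tuple wn))//= lerDl.
by apply: sumr_ge0 => v _; rewrite F0// size_tuple.
Qed.

Lemma wsum_nseq_gt0 n F (i : I) : (forall w, 0 < F w) -> 0 < wsum n F.
Proof.
move=> F0; apply: (lt_le_trans (F0 (nseq n i))).
by apply: ler_wsum_term => [w _|]; [exact: ltW|rewrite size_nseq].
Qed.

End word_sums.

(** * Sequences that are additive up to a bounded error *)

Section quasi_additive_sequences.
Context {R : realType}.

(** Estimates between exponential rates are proved at length [n] up to an additive constant; this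
    removes the constant. *)
Lemma le0_frequently (x C : R) :
  (forall N : nat, exists2 n, (N <= n)%N & n%:R * x <= C) -> x <= 0.
Proof.
move=> h; rewrite leNgt; apply/negP => x0.
have [n Nn] := h (Num.bound `|C / x|).
have : C / x < n%:R.
  apply: le_lt_trans (ler_norm _) (lt_le_trans (archi_boundP _) _) => //.
  by rewrite ler_nat.
rewrite ltr_pdivrMr//; lra.
Qed.

Lemma le0_archi (x C : R) : (forall n : nat, n%:R * x <= C) -> x <= 0.
Proof. by move=> h; apply: (@le0_frequently _ C) => N; exists N. Qed.

(** A two-sided Fekete argument. Comparing [u] at a common multiple of two indices shows that every
    (u n - D) / n lies below every (u j + D) / j, so any number in between, here a supremum, serves
    as [l]. *)
Lemma quasi_additive_limit (u : nat -> R) (D : R) :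
  (forall n k, `|u (n + k)%N - u n - u k| <= D) ->
  exists l, forall n, `|u n - n%:R * l| <= D.
Proof.
move=> uD.
have D0 : 0 <= D by apply: le_trans (uD 0 0)%N.
have uM (j n : nat) : `|u (j.+1 * n)%N - j.+1%:R * u n| <= j%:R * D.
  elim: j => [|j IH]; first by rewrite mul1n mul1r subrr normr0 mul0r.
  rewrite mulSn; have := uD n (j.+1 * n)%N; move: IH.
  rewrite !ler_norml -natr1 -[j.+2%:R]natr1 -natr1; lra.
have cross (j n : nat) : j.+1%:R * (u n.+1 - D) <= n.+1%:R * (u j.+1 + D).
  have := uM j n.+1; have := uM n j.+1; rewrite mulnC !ler_norml.
  have := D0; rewrite -[j.+1%:R]natr1 -[n.+1%:R]natr1; lra.
pose S := [set (u n.+1 - D) / n.+1%:R | n in [set: nat]].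
have S_ub (j : nat) : ubound S ((u j.+1 + D) / j.+1%:R).
  move=> _ [n _ <-].
  by rewrite ler_pdivlMr ?ltr0n// mulrAC ler_pdivrMr ?ltr0n// mulrC
    [leRHS]mulrC; exact: cross.
exists (sup S) => -[|n].
  by have := uD 0%N 0%N; rewrite mul0r subr0 addn0 !ler_norml; lra.
have S1 : (u n.+1 - D) / n.+1%:R <= sup S.
  by apply: ub_le_sup; [exists ((u 1%N + D) / 1%:R); exact: S_ub|exists n].
have S2 : sup S <= (u n.+1 + D) / n.+1%:R.
  by apply: sup_le_ub; [exists ((u 1%N - D) / 1%:R), 0%N|exact: S_ub].
move: S1 S2; rewrite ler_pdivrMr ?ltr0n// ler_pdivlMr ?ltr0n// ler_norml.
by rewrite [n.+1%:R * _]mulrC; lra.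
Qed.

Lemma quasi_additive_cvg (u : nat -> R) (D l : R) :
  (forall n, `|u n - n%:R * l| <= D) -> n%:R^-1 * u n @[n --> \oo] --> l.
Proof.
move=> uD; apply/cvgrPdist_le => e e0; near=> n.
have n0 : 0 < n%:R :> R by rewrite ltr0n; near: n; exact: nbhs_infty_gt.
have -> : l - n%:R^-1 * u n = n%:R^-1 * (n%:R * l - u n).
  by rewrite mulrBr mulKf// gt_eqF.
rewrite normrM distrC gtr0_norm ?invr_gt0// mulrC ler_pdivrMr//.
apply: le_trans (uD n) _; rewrite -ler_pdivrMl//.
by near: n; exact: nbhs_infty_ger.
Unshelve. all: by end_near. Qed.

End quasi_additive_sequences.

(** * Gibbs contents: existence *)

Section ultralimits.
Context {R : realType}.

(** One ultrafilter gives limits for the values at all words at once, in place of a diagonal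
    extraction of subsequences. *)
Lemma ultrafilter_infty : exists U : set_system nat,
  [/\ ProperFilter U, \oo `<=` U &
  forall (u : nat -> R) a b, (\forall n \near \oo, a <= u n <= b) ->
    exists2 l, a <= l <= b & u n @[n --> U] --> l].
Proof.
have [U [UU oU]] := ultraFilterLemma eventually_filter.
exists U; split => //; first exact: ultra_proper.
move=> u a b uab.
have := @segment_compact R a b; rewrite compact_ultra.
move=> /(_ (u n @[n --> U]))[||l []].
  split; first exact: fmap_proper_filter.
  move=> G PG UG; apply/seteqP; split => [A GA|]; last exact: UG.
  have [//|UnA] := in_ultra_setVsetC (u @^-1` A) UU.
  by have [x []] := @filter_ex _ _ PG _ (filterI GA (UG (~` A) UnA)).
  by apply: oU; apply: filterS uab => n /=; rewrite in_itv.
by rewrite /= in_itv; exists l.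
Qed.

Lemma cvg_bigsum {T : Type} {F : set_system T} {FF : Filter F} (J : finType)
    (P : pred J) (u : T -> J -> R) (l : J -> R) :
  (forall j, u x j @[x --> F] --> l j) ->
  \sum_(j | P j) u x j @[x --> F] --> \sum_(j | P j) l j.
Proof. by move=> ul; apply: cvg_big => //; exact: add_continuous. Qed.

End ultralimits.

Section contents.
Context {R : realType} {I : finType} (i0 : I).
Implicit Types (m phi : seq I -> R) (u v w : seq I) (n k : nat).

(* The values on cylinders of a shift-invariant probability measure. *)
Definition word_content m := [/\ m [::] = 1, forall w, 0 <= m w,
  forall w, \sum_i m (rcons w i) = m w & forall w, \sum_i m (i :: w) = m w].

Lemma content_suffix m n w : word_content m -> wsum n (fun v => m (w ++ v)) = m w.
Proof.
move=> [_ _ mr _]; elim: n => [|n IH]; first by rewrite wsum0 cats0.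
by rewrite wsumSr -IH; apply: eq_wsum => v _; rewrite -mr;
  apply: eq_bigr => i _; rewrite rcons_cat.
Qed.

Lemma content_prefix m n w : word_content m -> wsum n (fun v => m (v ++ w)) = m w.
Proof.
move=> [_ _ _ ml]; elim: n => [|n IH]; first by rewrite wsum0.
rewrite wsumS -[RHS]IH -wsum_bigr; apply: eq_wsum => v _.
by rewrite -ml.
Qed.

Lemma content_mass m n : word_content m -> wsum n m = 1.
Proof. by move=> mc; have /= -> := content_suffix n [::] mc; case: mc. Qed.

Definition quasi_additive phi D :=
  forall u v, `|phi (u ++ v) - phi u - phi v| <= D.

(** Bounds at every length instead of a limit: later arguments use the explicit error at a fixed
    length. *)
Definition has_pressure phi P D := forall n,
  expR (n%:R * P - D) <= wsum n (fun w => expR (phi w)) <= expR (n%:R * P + D).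

Definition gibbs_content phi P C m := word_content m /\ forall w,
  expR (phi w - (size w)%:R * P - C) <= m w <= expR (phi w - (size w)%:R * P + C).

Lemma partition_gt0 phi n : 0 < wsum n (fun w => expR (phi w)).
Proof. by apply: wsum_nseq_gt0 i0 _ => w; exact: expR_gt0. Qed.

Lemma quasi_additive_partition phi D u n : quasi_additive phi D ->
  expR (phi u - D) * wsum n (fun w => expR (phi w))
    <= wsum n (fun w => expR (phi (u ++ w)))
    <= expR (phi u + D) * wsum n (fun w => expR (phi w)).
Proof.
move=> qa; rewrite -!wsumMl; apply/andP; split; apply: ler_wsum => w _;
  by rewrite -expRD ler_expR; have := qa u w; rewrite ler_norml; lra.
Qed.

Lemma quasi_additive_pressure phi D : quasi_additive phi D ->
  exists P, has_pressure phi P D.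
Proof.
move=> qa; pose Z n := wsum n (fun w => expR (phi w)).
have ZE n : Z n = expR (ln (Z n)) by rewrite lnK// posrE partition_gt0.
have [n k|P ZP] := @quasi_additive_limit _ (fun n => ln (Z n)) D.
  have : expR (ln (Z n) + ln (Z k) - D) <= expR (ln (Z (n + k)%N))
           <= expR (ln (Z n) + ln (Z k) + D).
    rewrite !expRD -!ZE {1 5}/Z [Z (n + k)%N]wsumD -!wsumMr.
    apply/andP; split; apply: ler_wsum => u _;
      have /andP[] := quasi_additive_partition u k qa; rewrite !expRD /Z; lra.
  by rewrite !ler_expR ler_norml; lra.
exists P => n; rewrite -/(Z n) ZE !ler_expR.
by have := ZP n; rewrite ler_norml; lra.
Qed.

(* Limits of the prefix marginals of the normalised weights [expR (phi w)]. *)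
Lemma gibbs_suffix_content phi P D : quasi_additive phi D ->
  has_pressure phi P D -> exists q : seq I -> R,
  [/\ q [::] = 1, forall w, \sum_i q (rcons w i) = q w & forall w,
    expR (phi w - (size w)%:R * P - 3 * D) <= q w
      <= expR (phi w - (size w)%:R * P + 3 * D)].
Proof.
move=> qa pr; pose Z n := wsum n (fun w => expR (phi w)).
have Z0 n : 0 < Z n by exact: partition_gt0.
have [U [UP oU Ulim]] := @ultrafilter_infty R.
pose p w N := wsum (N - size w) (fun v => expR (phi (w ++ v))) / Z N.
have p_bd w : \forall N \near \oo,
    expR (phi w - (size w)%:R * P - 3 * D) <= p w N
      <= expR (phi w - (size w)%:R * P + 3 * D).
  near=> N.
  have wN : (size w <= N)%N by near: N; exact: nbhs_infty_ge.
  (* The error [3 * D] consists of one [D] for splitting off [w] and one for each of the partition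
     functions at [N] and [N - size w]. *)
  have /andP[lo hi] := quasi_additive_partition w (N - size w) qa.
  have /andP[ZN1 ZN2] := pr N; have /andP[Zk1 Zk2] := pr (N - size w)%N.
  rewrite /p ler_pdivlMr// ler_pdivrMr//; apply/andP; split.
    apply: le_trans lo; rewrite -/(Z N) in ZN2.
    apply: (@le_trans _ _ (expR (phi w - D) * expR ((N - size w)%:R * P - D))).
      apply: le_trans (ler_wpM2l (expR_ge0 _) ZN2) _.
      by rewrite -!expRD ler_expR natrB//; lra.
    by rewrite ler_wpM2l// expR_ge0.
  apply: le_trans hi _; rewrite -/(Z N) in ZN1.
  apply: le_trans (ler_wpM2l (expR_ge0 _) Zk2) _.
  apply: le_trans (ler_wpM2l (expR_ge0 _) ZN1).
  by rewrite -!expRD ler_expR natrB//; lra.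
have {}p_bd w := Ulim _ _ _ (p_bd w).
pose q w := s2val (cid2 (p_bd w)).
have q_bd w : expR (phi w - (size w)%:R * P - 3 * D) <= q w
      <= expR (phi w - (size w)%:R * P + 3 * D) by rewrite /q; case: cid2.
have pq w : p w N @[N --> U] --> q w by rewrite /q; case: cid2.
exists q; split => //.
  apply: (cvg_unique (@Rhausdorff R) (pq [::])) => //.
  rewrite (_ : p [::] = cst 1); first exact: cvg_cst.
  by apply/funext => N; rewrite /p/= subn0; apply: divff; rewrite gt_eqF// Z0.
move=> w; apply/esym; apply: (cvg_unique (@Rhausdorff R) (pq w)) => //.
apply: cvg_trans; last exact: (cvg_bigsum (fun i => pq (rcons w i))).
apply: near_eq_cvg; apply: oU; near=> N.
have wN : (size w < N)%N by near: N; exact: nbhs_infty_gt.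
suff : \sum_i p (rcons w i) N = p w N by [].
rewrite /p -mulr_suml; congr (_ / _); rewrite -(subnSK wN) wsumS.
apply: eq_bigr => i _; rewrite size_rcons.
by apply: eq_wsum => v _; rewrite cat_rcons.
Unshelve. all: by end_near. Qed.

(* Cesaro averages over the starting position restore shift invariance. *)
Lemma gibbs_content_exists phi P D : quasi_additive phi D ->
  has_pressure phi P D -> exists m, gibbs_content phi P (5 * D) m.
Proof.
move=> qa pr.
have [q [q1 qr q_bd]] := gibbs_suffix_content qa pr.
have q_ge0 w : 0 <= q w by apply: le_trans (expR_ge0 _) (andP (q_bd w)).1.
have qs n : wsum n q = 1.
  by elim: n => [|n IH]; [rewrite wsum0|rewrite wsumSr -IH; apply: eq_wsum].
have [U [UP oU Ulim]] := @ultrafilter_infty R.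
pose a k w := wsum k (fun u => q (u ++ w)).
(* The bounds on [q] contribute [3 * D], splitting [u ++ w] one [D], and the partition function of
   length [k] another. *)
have a_bd k w : expR (phi w - (size w)%:R * P - 5 * D) <= a k w
      <= expR (phi w - (size w)%:R * P + 5 * D).
  have /andP[Zk1 Zk2] := pr k.
  apply/andP; split.
    apply: (@le_trans _ _ (expR (phi w - (k + size w)%:R * P - 4 * D) *
        wsum k (fun w => expR (phi w)))).
      apply: le_trans (ler_wpM2l (expR_ge0 _) Zk1).
      by rewrite -expRD ler_expR natrD; lra.
    rewrite -wsumMl; apply: ler_wsum => u uk.
    have /andP[+ _] := q_bd (u ++ w); apply: le_trans.
    rewrite -expRD ler_expR size_cat uk; have := qa u w; rewrite ler_norml; lra.
  apply: (@le_trans _ _ (expR (phi w - (k + size w)%:R * P + 4 * D) *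
      wsum k (fun w => expR (phi w)))); last first.
    apply: le_trans (ler_wpM2l (expR_ge0 _) Zk2) _.
    by rewrite -expRD ler_expR natrD; lra.
  rewrite -wsumMl; apply: ler_wsum => u uk.
  have /andP[_ +] := q_bd (u ++ w); move=> /le_trans; apply.
  rewrite -expRD ler_expR size_cat uk; have := qa u w; rewrite ler_norml; lra.
pose p w n := n.+1%:R^-1 * \sum_(k < n.+1) a k w.
have p_bd w : \forall n \near \oo,
    expR (phi w - (size w)%:R * P - 5 * D) <= p w n
      <= expR (phi w - (size w)%:R * P + 5 * D).
  near=> n; rewrite /p ler_pdivlMl ?ltr0n// ler_pdivrMl ?ltr0n//.
  have card (x : R) : n.+1%:R * x = \sum_(k < n.+1) x.
    by rewrite sumr_const card_ord mulr_natl.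
  by rewrite !card; apply/andP; split; apply: ler_sum => k _;
    case/andP: (a_bd k w).
have {}p_bd w := Ulim _ _ _ (p_bd w).
pose m w := s2val (cid2 (p_bd w)).
have m_bd w : expR (phi w - (size w)%:R * P - 5 * D) <= m w
      <= expR (phi w - (size w)%:R * P + 5 * D) by rewrite /m; case: cid2.
have pm w : p w n @[n --> U] --> m w by rewrite /m; case: cid2.
exists m; split => //; split.
- apply: (cvg_unique (@Rhausdorff R) (pm [::])) => //.
  rewrite (_ : p [::] = cst 1); first exact: cvg_cst.
  apply/funext => n; rewrite /p (eq_bigr (fun=> 1)) => [|k _].
    by rewrite sumr_const card_ord mulVf// pnatr_eq0.
  by rewrite /a -[RHS](qs k); apply: eq_wsum => u _; rewrite cats0.
- by move=> w; apply: le_trans (expR_ge0 _) (andP (m_bd w)).1.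
- move=> w; apply/esym; apply: (cvg_unique (@Rhausdorff R) (pm w)) => //.
  apply: cvg_trans; last exact: (cvg_bigsum (fun i => pm (rcons w i))).
  apply: near_eq_cvg; apply: oU; near=> n.
  rewrite /p -mulr_sumr exchange_big/=; congr (_ * _).
  apply: eq_bigr => k _; rewrite /a -wsum_bigr; apply: eq_wsum => u _.
  by rewrite -qr; apply: eq_bigr => i _; rewrite rcons_cat.
- move=> w; apply/esym; apply: (cvg_unique (@Rhausdorff R) (pm w)) => //.
  suff : p w n @[n --> U] --> \sum_i m (i :: w) + 0 by rewrite addr0.
  (* Summing over a prepended letter turns [a k] into [a k.+1], so the two averages differ by a
     boundary term of order 1 / n. *)
  have -> : p w = (fun n => \sum_i p (i :: w) n +
      n.+1%:R^-1 * (a 0%N w - a n.+1 w)).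
    apply/funext => n; rewrite /p -mulr_sumr exchange_big/= -mulrDr.
    congr (_ * _); rewrite big_ord_recl (eq_bigr (fun k : 'I_n.+1 => a k.+1 w)).
      rewrite [X in _ = X + _]big_ord_recr/=.
      rewrite (eq_bigr (fun k : 'I_n => a k.+1 w)) => [|k _]; first lra.
      by rewrite /bump.
    move=> k _; rewrite /a wsumSr -wsum_bigr; apply: eq_wsum => u _.
    by apply: eq_bigr => i _; rewrite cat_rcons.
  apply: cvgD; first exact: (cvg_bigsum (fun i => pm (i :: w))).
  suff : n.+1%:R^-1 * (a 0%N w - a n.+1 w) @[n --> \oo] --> 0.
    by move=> c A nA; apply: oU; exact: c.
  pose b := expR (phi w - (size w)%:R * P + 5 * D).
  apply: (@squeeze_cvgr _ _ _ _ (fun n => - (b * n.+1%:R^-1))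
     (fun n => b * n.+1%:R^-1)).
  + near=> n; have := a_bd 0%N w; have := a_bd n.+1 w; rewrite -/b.
    have := expR_ge0 (phi w - (size w)%:R * P - 5 * D).
    set x := expR _ => x0 /andP[a1 a2] /andP[a3 a4].
    have n0 : 0 <= n.+1%:R^-1 :> R by rewrite invr_ge0.
    have d1 : - b <= a 0%N w - a n.+1 w by lra.
    have d2 : a 0%N w - a n.+1 w <= b by lra.
    move: n.+1%:R^-1 n0 (ler_wpM2l n0 d1) (ler_wpM2l n0 d2) => y _ h1 h2.
    by apply/andP; split; lra.
  + suff : - (b * n.+1%:R^-1) @[n --> \oo] --> - (b * 0).
      by rewrite mulr0 oppr0.
    by apply: cvgN; apply: cvgMl_tmp; exact: cvg_harmonic.
  + suff : b * n.+1%:R^-1 @[n --> \oo] --> b * 0 by rewrite mulr0.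
    by apply: cvgMl_tmp; exact: cvg_harmonic.
Unshelve. all: by end_near. Qed.

End contents.

(** * Gibbs contents: uniqueness *)

Section relative_entropy.
Context {R : realType} {I : finType} (i0 : I).
Implicit Types (m rho phi : seq I -> R) (u v w : seq I) (n k : nat).

(* Tangent lines of the convex function [x ln x] at [x = expR (- l)]. *)
Lemma entropy_tangent (l a b : R) : 0 < a -> 0 < b ->
  (1 - l) * a - expR (- l) * b <= a * ln (a / b).
Proof.
move=> a0 b0; have := expR_ge1Dx (- l - ln (a / b)).
rewrite expRD (expRN (ln _)) lnK ?posrE ?divr_gt0// invf_div => /(ler_wpM2l (ltW a0)).
rewrite mulrCA (mulrCA a b) divff ?gt_eqF// mulr1.
lra.
Qed.

Definition entropy rho m n := wsum n (fun w => rho w * ln (rho w / m w)).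

(** By the chain rule the entropy increment compares [rho] with [b u v], the extension of [rho u] by
    the conditional weights of [m]. Its terms can be made nonnegative, and the single term of [w]
    already gives the bound; invariance of [rho] removes the prefix [u]. *)
Lemma entropy_growth m rho kappa w n : word_content m -> word_content rho ->
  (forall w, 0 < m w) -> (forall w, 0 < rho w) ->
  (forall u v, kappa * m u * m v <= m (u ++ v)) ->
  entropy rho m n + ((1 - expR (- 1)) * kappa * m w - rho w)
    <= entropy rho m (n + size w).
Proof.
move=> mc rc m0 r0 mk; set k := size w.
have e1 : 0 <= 1 - expR (- 1) :> R by rewrite subr_ge0 expR_le1 lerN10.
pose b u v := rho u * m (u ++ v) / m u.
have b0 u v : 0 < b u v by rewrite !mulr_gt0// invr_gt0.
have {1}-> : m w = wsum n (fun u => rho u * m w).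
  by rewrite wsumMr content_mass// mul1r.
rewrite {1}/entropy -[rho w](content_prefix n w rc) -wsumMl -wsum_sub -wsum_add.
rewrite /entropy wsumD; apply: ler_wsum => u _.
have -> : rho u * ln (rho u / m u) =
    wsum k (fun v => rho (u ++ v) * ln (rho u / m u)).
  by rewrite wsumMr content_suffix.
rewrite addrC -lerBrDr -wsum_sub.
(* The inserted terms [- rho (u ++ v) + b u v] sum to zero over [v]; with them each summand is
   nonnegative by the tangent at [l = 0], and the summand of [w] is estimated by the tangent at
   [l = 1]. *)
have -> : wsum k (fun v => rho (u ++ v) * ln (rho (u ++ v) / m (u ++ v)) -
      rho (u ++ v) * ln (rho u / m u)) =
    wsum k (fun v => rho (u ++ v) * ln (rho (u ++ v) / b u v) -
      rho (u ++ v) + b u v).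
  rewrite [RHS]wsum_add [X in _ = X + _]wsum_sub (content_suffix _ _ rc).
  rewrite /b wsumMr wsumMl (content_suffix _ _ mc) mulfK ?gt_eqF//.
  rewrite subrK; apply: eq_wsum => v _.
  rewrite -mulrBr -ln_div ?posrE ?divr_gt0//; congr (_ * ln _).
  by field; rewrite !gt_eqF.
apply: le_trans (ler_wsum_term (w := w) _ _) => //.
  have := entropy_tangent 1 (r0 (u ++ w)) (b0 u w).
  have : kappa * m w * rho u <= b u w.
    rewrite /b ler_pdivlMr//; have := ler_wpM2l (ltW (r0 u)) (mk u w); lra.
  move=> /(ler_wpM2l e1). lra.
move=> v _; have := entropy_tangent 0 (r0 (u ++ v)) (b0 u v).
by rewrite oppr0 expR0; lra.
Qed.

(* Bounded relative entropy with respect to a quasi-Bernoulli content forces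
   absolute continuity in the other direction, uniformly: otherwise the entropy
   would grow linearly. *)
Lemma bounded_entropy_lower_bound m rho kappa M :
  word_content m -> word_content rho -> (forall w, 0 < m w) -> (forall w, 0 < rho w) ->
  (forall u v, kappa * m u * m v <= m (u ++ v)) ->
  (forall n, entropy rho m n <= M) ->
  forall w, (1 - expR (- 1)) * kappa * m w <= rho w.
Proof.
move=> mc rc m0 r0 mk HM w; rewrite -subr_le0.
apply: (@le0_archi _ _ (M - entropy rho m 0)) => j.
suff : entropy rho m 0 + j%:R * ((1 - expR (- 1)) * kappa * m w - rho w)
    <= entropy rho m (j * size w) by have := HM (j * size w)%N; lra.
elim: j => [|j IH]; first by rewrite mul0r addr0 mul0n.
have := entropy_growth w (j * size w) mc rc m0 r0 mk.
by rewrite mulSnr -natr1; move: IH; lra.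
Qed.

End relative_entropy.

Section gibbs_uniqueness.
Context {R : realType} {I : finType} (i0 : I).
Implicit Types (m phi : seq I -> R) (u v w : seq I) (n k : nat).

Lemma gibbs_content_gt0 phi P C m w : gibbs_content phi P C m -> 0 < m w.
Proof. by move=> [_ /(_ w)/andP[+ _]]; apply: lt_le_trans; exact: expR_gt0. Qed.

Lemma gibbs_quasi_bernoulli phi P C D m u v : quasi_additive phi D ->
  gibbs_content phi P C m ->
  expR (- (3 * C + D)) * m u * m v <= m (u ++ v) <=
    expR (3 * C + D) * m u * m v.
Proof.
move=> qa [_ mg].
have /andP[u1 u2] := mg u; have /andP[v1 v2] := mg v.
have /andP[uv1 uv2] := mg (u ++ v).
have := qa u v; rewrite ler_norml => /andP[q1 q2].
rewrite size_cat natrD in uv1 uv2; apply/andP; split.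
  apply: le_trans uv1; rewrite -mulrA.
  apply: (@le_trans _ _ (expR (- (3 * C + D)) *
    (expR (phi u - (size u)%:R * P + C) * expR (phi v - (size v)%:R * P + C)))).
    by rewrite ler_wpM2l ?expR_ge0// ler_pM ?(le_trans (expR_ge0 _) u1)
      ?(le_trans (expR_ge0 _) v1).
  by rewrite -!expRD ler_expR; lra.
apply: (le_trans uv2); rewrite -mulrA.
apply: (@le_trans _ _ (expR (3 * C + D) *
  (expR (phi u - (size u)%:R * P - C) * expR (phi v - (size v)%:R * P - C)))).
  by rewrite -!expRD ler_expR; lra.
by rewrite ler_wpM2l ?expR_ge0// ler_pM ?expR_ge0.
Qed.

Lemma gibbs_comparable phi P C1 C2 m1 m2 w :
  gibbs_content phi P C1 m1 -> gibbs_content phi P C2 m2 ->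
  m2 w <= expR (C1 + C2) * m1 w.
Proof.
move=> [_ /(_ w)/andP[m1w _]] [_ /(_ w)/andP[_ m2w]].
apply: (le_trans m2w); apply: le_trans (ler_wpM2l (expR_ge0 _) m1w).
by rewrite -expRD ler_expR; lra.
Qed.

(* If [s] is the largest real with [s m1 <= m2] and [s < 1], then the normalisation
   of [m2 - r m1], for [r] slightly below [s], is bounded below by a fixed multiple
   of [m1], which contradicts the maximality of [s]. *)
Lemma gibbs_content_unique phi P D C1 C2 m1 m2 : quasi_additive phi D ->
  gibbs_content phi P C1 m1 -> gibbs_content phi P C2 m2 -> m1 =1 m2.
Proof.
move=> qa g1 g2.
have [c1 _] := g1; have [c2 _] := g2.
have m10 w := gibbs_content_gt0 w g1; have m20 w := gibbs_content_gt0 w g2.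
have [m11 _ m1r m1l] := c1; have [m21 _ m2r m2l] := c2.
pose S := [set r : R | forall w, r * m1 w <= m2 w].
have S1 r : S r -> r <= 1 by move=> /(_ [::]); rewrite m11 m21 mulr1.
have hS : has_sup S.
  split; last by exists 1 => r /S1.
  exists (expR (- (C2 + C1))) => w.
  by rewrite expRN ler_pdivrMl ?expR_gt0// (gibbs_comparable _ g2 g1).
pose s := sup S.
have s1 : s <= 1 by apply: sup_le_ub; [case: hS|move=> r /S1].
have s0 : 0 < s.
  apply: (@lt_le_trans _ _ (expR (- (C2 + C1)))); first exact: expR_gt0.
  apply: ub_le_sup; first by case: hS.
  by move=> w; rewrite expRN ler_pdivrMl ?expR_gt0// (gibbs_comparable _ g2 g1).
have Ss : S s.
  move=> w; rewrite -ler_pdivlMr//; apply: sup_le_ub; first by case: hS.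
  by move=> r Sr; rewrite ler_pdivlMr.
suff s_ge1 : 1 <= s.
  move=> w; apply/eqP; rewrite eq_le; apply/andP; split.
    by apply: le_trans (Ss w); rewrite ler_peMl// ltW.
  rewrite -subr_le0.
  have <- : wsum (size w) (fun w => m2 w - m1 w) = 0.
    by rewrite wsum_sub !content_mass// subrr.
  apply: (ler_wsum_term (F := fun w => m2 w - m1 w)) => // v _.
  by rewrite subr_ge0 (le_trans _ (Ss v))// ler_peMl// ltW.
rewrite leNgt; apply/negP => s_lt1.
pose kappa := expR (- (3 * C1 + D)); pose c := (1 - expR (- 1)) * kappa.
have c0 : 0 < c by rewrite mulr_gt0 ?expR_gt0// subr_gt0 expR_lt1 ltrN10.
(* The first bound makes the gain [c * (1 - r)] exceed the loss [e]; the second keeps [r] positive,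
   so that [rho] is at most [m2 / (1 - r)] and has bounded entropy with respect to [m1]. *)
pose e := Num.min (c * (1 - s) / 2) (s / 2).
have cs0 : 0 < c * (1 - s) by rewrite mulr_gt0// subr_gt0.
have e0 : 0 < e by rewrite lt_min !divr_gt0.
have ec : e <= c * (1 - s) / 2 by rewrite ge_min lexx.
have es : e <= s / 2 by rewrite ge_min lexx orbT.
pose r := s - e; pose rho w := (m2 w - r * m1 w) / (1 - r).
have r1 : 0 < 1 - r by rewrite /r; lra.
have rho0 w : 0 < rho w.
  apply: divr_gt0 => //; have := Ss w; have := mulr_gt0 e0 (m10 w).
  by rewrite /r; lra.
have rc : word_content rho.
  split=> [|w|w|w]; first by rewrite /rho m11 m21 mulr1 divff// gt_eqF.
  - exact: ltW.
  - by rewrite /rho -mulr_suml sumrB -mulr_sumr m1r m2r.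
  - by rewrite /rho -mulr_suml sumrB -mulr_sumr m1l m2l.
have rho_ge w : c * m1 w <= rho w.
  apply: (bounded_entropy_lower_bound (kappa := kappa)
    (M := ln (expR (C1 + C2) / (1 - r))) c1 rc m10 rho0) => [u v|n].
  - by have /andP[] := gibbs_quasi_bernoulli u v qa g1.
  - set M := ln _; have -> : M = wsum n (fun w => rho w * M).
      by rewrite wsumMr content_mass// mul1r.
    apply: ler_wsum => v _; apply: ler_wpM2l; first exact: ltW.
    have q1 : 0 < rho v / m1 v by exact: divr_gt0.
    have q2 : 0 < expR (C1 + C2) / (1 - r) by apply: divr_gt0 => //; exact: expR_gt0.
    rewrite ler_ln ?posrE// ler_pdivrMr// [leRHS]mulrAC ler_pM2r ?invr_gt0//.
    have := gibbs_comparable v g1 g2; have : 0 <= r * m1 v; last lra.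
    by rewrite mulr_ge0// ?ltW// /r; lra.
have : S (r + c * (1 - r)).
  by move=> w; have := rho_ge w; rewrite ler_pdivlMr//; lra.
move/(ub_le_sup (proj2 hS)); rewrite -/s.
have := mulr_gt0 c0 e0; rewrite /r; lra.
Qed.

End gibbs_uniqueness.

(** * The pressure as a function of the parameter *)

Section means.
Context {R : realType} {I : finType} (i0 : I).
Implicit Types (m phi A B : seq I -> R) (u v w : seq I) (n k : nat).

Definition word_mean A m n := wsum n (fun w => m w * A w).

Definition has_mean A D m j := forall n, `|word_mean A m n - n%:R * j| <= D.

(** Invariance under appending and prepending writes both means over words of length n + k, where
    quasi-additivity of [A] applies termwise. *)
Lemma has_mean_exists A D m : word_content m -> quasi_additive A D ->
  exists j, has_mean A D m j.
Proof.
move=> mc qa; apply: quasi_additive_limit => n k.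
rewrite /word_mean wsumD.
have -> : wsum n (fun w => m w * A w) =
    wsum n (fun u => wsum k (fun v => m (u ++ v) * A u)).
  by apply: eq_wsum => u _; rewrite wsumMr content_suffix.
have -> : wsum k (fun w => m w * A w) =
    wsum n (fun u => wsum k (fun v => m (u ++ v) * A v)).
  by rewrite wsum_exchange; apply: eq_wsum => v _; rewrite wsumMr content_prefix.
have m0 w : 0 <= m w by case: mc.
have D_sum : D = wsum n (fun u => wsum k (fun v => m (u ++ v) * D)).
  rewrite -[LHS]mul1r -(content_mass n mc) -wsumMr; apply: eq_wsum => u _.
  by rewrite wsumMr content_suffix.
rewrite -!wsum_sub D_sum ler_norml -mulN1r -wsumMl.
apply/andP; split; apply: ler_wsum => u _; rewrite -!wsum_sub -?wsumMl;
  apply: ler_wsum => v _; rewrite -!mulrBr ?mulN1r -?mulrN ler_wpM2l//;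
  by have := qa u v; rewrite ler_norml => /andP[].
Qed.

Lemma has_mean_unique A D m j1 j2 :
  has_mean A D m j1 -> has_mean A D m j2 -> j1 = j2.
Proof.
move=> h1 h2; apply/eqP; rewrite eq_le -!(subr_le0 _ j1) -(subr_le0 _ j2).
apply/andP; split; apply: (@le0_archi _ _ (D + D)) => n;
  have := h1 n; have := h2 n; rewrite !ler_norml; lra.
Qed.

Lemma quasi_additive_linear A D : quasi_additive A D ->
  exists2 M, 0 <= M & forall w, `|A w| <= (size w)%:R * M + D.
Proof.
move=> qa; have D0 : 0 <= D by apply: le_trans (qa [::] [::]).
exists (\sum_i `|A [:: i]| + D).
  by rewrite addr_ge0// sumr_ge0.
elim=> [|i w IH].
  by have := qa [::] [::]; rewrite subrr sub0r normrN mul0r add0r.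
have : `|A [:: i]| <= \sum_j `|A [:: j]| by rewrite (bigD1 i)//= lerDl sumr_ge0.
have := qa [:: i] w; rewrite /= -[(_.+1)%:R]natr1 mulrDl mul1r.
move: IH; rewrite !ler_norml; lra.
Qed.

End means.

Section potentials.
Context {R : realType} {I : finType} (i0 : I).
Implicit Types (m phi A B : seq I -> R) (u v w : seq I) (n k : nat).

(* [A] and [B] stand for the word sums of [psi] and [f], so that this is the word
   sum of [s * psi + f] up to [potential_bound]. *)
Definition potential A B (s : R) w := s * A w + B w.
Definition potential_bound DA DB (s : R) : R := `|s| * DA + DB.

Lemma quasi_additive_potential A B DA DB s :
  quasi_additive A DA -> quasi_additive B DB ->
  quasi_additive (potential A B s) (potential_bound DA DB s).
Proof.
move=> qA qB u v; rewrite /potential.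
have -> : s * A (u ++ v) + B (u ++ v) - (s * A u + B u) - (s * A v + B v) =
    s * (A (u ++ v) - A u - A v) + (B (u ++ v) - B u - B v) by ring.
by apply: le_trans (ler_normD _ _) _; rewrite lerD// normrM ler_wpM2l.
Qed.

Definition pressure_family A B DA DB (P : R -> R) := forall s,
  has_pressure (potential A B s) (P s) (potential_bound DA DB s).

Lemma pressure_familyN A B DA DB P : pressure_family A B DA DB P ->
  pressure_family (fun w => - A w) B DA DB (fun s => P (- s)).
Proof.
move=> hP s n; have := hP (- s) n; rewrite /potential_bound normrN.
rewrite (_ : potential A B (- s) = potential (fun w => - A w) B s)//.
by apply/funext => w; rewrite /potential mulNr mulrN.
Qed.

Lemma quasi_additiveN A D : quasi_additive A D ->
  quasi_additive (fun w => - A w) D.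
Proof.
move=> qa u v; rewrite (_ : _ - _ - _ = - (A (u ++ v) - A u - A v)); last by ring.
by rewrite normrN.
Qed.

Lemma has_meanN A D m j : has_mean A D m j -> has_mean (fun w => - A w) D m (- j).
Proof.
move=> h n; have := h n; rewrite -normrN /word_mean.
have -> : wsum n (fun w => m w * - A w) = - wsum n (fun w => m w * A w).
  by rewrite -mulN1r -wsumMl; apply: eq_wsum => w _; ring.
by rewrite mulrN opprK opprB addrC.
Qed.

Section family.
Context {A B : seq I -> R} {DA DB : R} {P : R -> R}.
Context (qA : quasi_additive A DA) (qB : quasi_additive B DB).
Context (hP : pressure_family A B DA DB P).

Local Notation pot := (potential A B).
Local Notation E := (potential_bound DA DB).

Let DA_ge0 : 0 <= DA. Proof. exact: le_trans (qA [::] [::]). Qed.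

Lemma gibbs_subgradient s s' C m j : gibbs_content (pot s) (P s) C m ->
  has_mean A DA m j -> P s + (s' - s) * j <= P s'.
Proof.
move=> [mc mg] mj; rewrite -subr_le0.
apply: (@le0_archi _ _ (E s' + C + `|s' - s| * DA)) => n.
have [_ m0 _ _] := mc.
pose a := (s' - s) * word_mean A m n.
suff : expR (n%:R * P s - C + a) <= expR (n%:R * P s' + E s').
  rewrite ler_expR /a => h.
  have : `|(s' - s) * (word_mean A m n - n%:R * j)| <= `|s' - s| * DA.
    by rewrite normrM ler_wpM2l.
  by rewrite ler_norml; lra.
have /andP[_] := hP s' n; apply: le_trans.
apply: (@le_trans _ _ (wsum n (fun w => expR (n%:R * P s - C) *
    (m w * expR ((s' - s) * A w))))); last first.
  apply: ler_wsum => w wn; have /andP[_] := mg w.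
  move=> /(ler_wpM2r (expR_ge0 ((s' - s) * A w))).
  move=> /(ler_wpM2l (expR_ge0 (n%:R * P s - C))) /le_trans; apply.
  by rewrite wn -!expRD ler_expR /potential; lra.
rewrite wsumMl expRD ler_wpM2l ?expR_ge0//.
(* Jensen's inequality, from the tangent of the exponential at the mean. *)
have -> : expR a = wsum n (fun w => expR a * (m w * (1 + ((s' - s) * A w - a)))).
  rewrite wsumMl (@eq_wsum _ _ _ _ (fun w => (1 - a) * m w +
    (s' - s) * (m w * A w))) => [|w _]; last ring.
  by rewrite wsum_add !wsumMl content_mass// -/(word_mean A m n) -/a; ring.
apply: ler_wsum => w _; rewrite mulrCA ler_wpM2l//.
have := expR_ge1Dx ((s' - s) * A w - a).
move=> /(ler_wpM2l (expR_ge0 a)) /le_trans; apply.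
by rewrite -expRD addrC subrK.
Qed.

(** Zero is a subgradient at both parameters, so [P s = P t] and the log-density of [m1] with
    respect to [m2] is [(s - t) * A] up to a constant. Its [m1]-mean is bounded, hence so is the
    entropy, and the resulting lower bound on the density is the claim. *)
Lemma equal_means_bounded_below s t C1 C2 m1 m2 :
  gibbs_content (pot s) (P s) C1 m1 -> has_mean A DA m1 0 ->
  gibbs_content (pot t) (P t) C2 m2 -> has_mean A DA m2 0 ->
  exists M, forall w, M <= (s - t) * A w.
Proof.
move=> g1 j1 g2 j2.
have Pst : P s = P t.
  have := gibbs_subgradient t g1 j1; have := gibbs_subgradient s g2 j2.
  by rewrite !mulr0 !addr0 => h1 h2; apply/eqP; rewrite eq_le h1 h2.
have [c1 mg1] := g1; have [c2 mg2] := g2.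
have m10 w := gibbs_content_gt0 w g1; have m20 w := gibbs_content_gt0 w g2.
pose kappa := expR (- (3 * C2 + E t)); pose c := (1 - expR (- 1)) * kappa.
have c0 : 0 < c by rewrite mulr_gt0 ?expR_gt0// subr_gt0 expR_lt1 ltrN10.
have lower w : c * m2 w <= m1 w.
  apply: (bounded_entropy_lower_bound (kappa := kappa)
    (M := C1 + C2 + `|s - t| * DA) c2 c1 m20 m10) => [u v|n].
    by have /andP[] := gibbs_quasi_bernoulli u v (quasi_additive_potential t qA qB) g2.
  have : word_mean A m1 n * (s - t) <= `|s - t| * DA.
    apply: le_trans (ler_norm _) _; rewrite normrM mulrC ler_wpM2l//.
    by have := j1 n; rewrite mulr0 subr0.
  suff : entropy m1 m2 n <= (C1 + C2) + word_mean A m1 n * (s - t) by lra.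
  have -> : C1 + C2 = wsum n (fun w => m1 w * (C1 + C2)).
    by rewrite wsumMr content_mass// mul1r.
  rewrite -wsumMr -wsum_add; apply: ler_wsum => v vn.
  rewrite -mulrA -mulrDr ler_wpM2l ?(ltW (m10 v))//.
  have q0 : 0 < m1 v / m2 v by exact: divr_gt0.
  rewrite -ler_expR lnK ?posrE// ler_pdivrMr//.
  have /andP[_ /le_trans] := mg1 v; apply.
  have /andP[/(ler_wpM2l (expR_ge0 (C1 + C2 + A v * (s - t)))) + _] := mg2 v.
  by apply: le_trans; rewrite -expRD ler_expR /potential Pst; lra.
exists (ln c - C1 - C2) => w; rewrite -lerBrDr.
have /andP[_ h1] := mg1 w; have /andP[/(ler_wpM2l (ltW c0)) h2 _] := mg2 w.
have := le_trans (le_trans h2 (lower w)) h1.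
rewrite -{1}(@lnK _ c) ?posrE// -expRD ler_expR /potential Pst; lra.
Qed.

Lemma pressure_lipschitz : exists2 M, 0 <= M &
  forall s s', `|P s - P s'| <= M * `|s - s'|.
Proof.
have [M M0 AM] := quasi_additive_linear qA; exists M => //.
suff h s s' : P s' - P s <= M * `|s - s'|.
  by move=> s s'; rewrite ler_norml; have := h s s'; have := h s' s;
    rewrite [`|s' - s|]distrC; lra.
rewrite -subr_le0; apply: (@le0_archi _ _ (E s + E s' + `|s - s'| * DA)) => n.
have /andP[_ h1] := hP s n; have /andP[h2 _] := hP s' n.
suff : expR (n%:R * P s' - E s') <=
    expR (`|s - s'| * (n%:R * M + DA) + (n%:R * P s + E s)).
  by rewrite ler_expR; lra.
apply: (le_trans h2); rewrite [leRHS]expRD.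
apply: le_trans (ler_wpM2l (expR_ge0 _) h1); rewrite -wsumMl.
apply: ler_wsum => w wn; rewrite -expRD ler_expR /potential -wn.
have : (s' - s) * A w <= `|s - s'| * ((size w)%:R * M + DA).
  by apply: le_trans (ler_norm _) _; rewrite normrM distrC ler_wpM2l.
lra.
Qed.

(** The mean is controlled at each length [n], where it is a finite sum and passes to the limit; the
    asymptotic mean itself would require an exchange of limits. *)
Lemma gibbs_limit (s_ : nat -> R) (t : R) (m_ : nat -> seq I -> R) (C e : R) :
  s_ n @[n --> \oo] --> t ->
  (forall n, gibbs_content (pot (s_ n)) (P (s_ n)) C (m_ n)) ->
  (forall k n, n%:R * e - DA <= word_mean A (m_ k) n) ->
  exists2 m, gibbs_content (pot t) (P t) C m &
    forall n, n%:R * e - DA <= word_mean A m n.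
Proof.
move=> st mg me; have [U [UP oU Ulim]] := @ultrafilter_infty R.
have [M M0 PM] := pressure_lipschitz.
have sU : s_ n @[n --> U] --> t by move=> V /st; exact: oU.
have PU : P (s_ n) @[n --> U] --> P t.
  apply/cvgrPdist_le => d d0; have dM : 0 < d / (M + 1) by rewrite divr_gt0//; lra.
  move/cvgrPdist_le : sU => /(_ _ dM); apply: filterS => n sn.
  apply: le_trans (PM _ _) _; move: sn; rewrite ler_pdivlMr; last lra.
  by have := normr_ge0 (t - s_ n); lra.
have m01 n w : 0 <= m_ n w <= 1.
  have [mc _] := mg n; have [_ m0 _ _] := mc; rewrite m0/=.
  by rewrite -(content_mass (size w) mc) ler_wsum_term.
have cvgm w : exists2 l : R, 0 <= l <= 1 & m_ n w @[n --> U] --> l.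
  by apply: Ulim; exact: nearW.
pose m w := s2val (cid2 (cvgm w)).
have mm w : m_ n w @[n --> U] --> m w by rewrite /m; case: cid2.
have bnd (x y : nat -> R) (a b : R) : x n @[n --> U] --> a ->
    y n @[n --> U] --> b -> (forall n, x n <= y n) -> a <= b.
  by move=> xa yb xy; apply: ler_cvg_to xa yb _; exact: nearW.
have eqU (x : nat -> R) (a b : R) : x n @[n --> U] --> a ->
    x n @[n --> U] --> b -> a = b by exact: (cvg_unique (@Rhausdorff R)).
exists m; first split; first split.
- apply: (eqU _ _ _ (mm [::])).
  rewrite (_ : (fun n => _) = cst 1); first exact: cvg_cst.
  by apply/funext => n; have [[]] := mg n.
- by move=> w; apply: bnd (cvg_cst 0) (mm w) _ => n; case/andP: (m01 n w).
- move=> w; apply: eqU (mm w).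
  rewrite (_ : (fun n => _) = fun n => \sum_i m_ n (rcons w i)).
    exact: (cvg_bigsum (fun i => mm (rcons w i))).
  by apply/funext => n; have [[_ _ -> _]] := mg n.
- move=> w; apply: eqU (mm w).
  rewrite (_ : (fun n => _) = fun n => \sum_i m_ n (i :: w)).
    exact: (cvg_bigsum (fun i => mm (i :: w))).
  by apply/funext => n; have [[_ _ _ ->]] := mg n.
- move=> w.
  have lim (c : R) : expR (pot (s_ n) w - (size w)%:R * P (s_ n) + c) @[n --> U] -->
      expR (pot t w - (size w)%:R * P t + c).
    apply: continuous_cvg; first exact: continuous_expR.
    apply: cvgD; last exact: cvg_cst.
    apply: cvgB; last by apply: cvgMl_tmp.
    by apply: cvgD; [apply: cvgMr_tmp|exact: cvg_cst].
  apply/andP; split.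
    by apply: bnd (lim (- C)) (mm w) _ => n; have [_ /(_ w)/andP[]] := mg n.
  by apply: bnd (mm w) (lim C) _ => n; have [_ /(_ w)/andP[]] := mg n.
- move=> n; apply: bnd (cvg_cst (n%:R * e - DA)) _ (fun k => me k n).
  apply: cvg_bigsum => w; exact: cvgMr_tmp.
Qed.

Lemma has_mean_ge m (j e : R) : has_mean A DA m j ->
  (forall n, n%:R * e - DA <= word_mean A m n) -> e <= j.
Proof.
move=> mj me; rewrite -subr_le0; apply: (@le0_archi _ _ (DA + DA)) => n.
by have := mj n; have := me n; rewrite ler_norml; lra.
Qed.

(** The subgradient inequality at t + 1 / (n + 1), evaluated at [t], forces the Gibbs means there to
    be at least [e]; then compactness. *)
Lemma gibbs_right_limit (t e : R) : (forall a : R, 0 < a <= 1 -> P t + a * e <= P (t + a)) ->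
  exists m C j, [/\ gibbs_content (pot t) (P t) C m, has_mean A DA m j & e <= j].
Proof.
move=> he; pose s_ n := t + n.+1%:R^-1.
have a01 n : 0 < (n.+1%:R^-1 : R) <= 1.
  by rewrite invr_gt0 ltr0n/= invf_le1 ?ltr0n// ler1n.
(* Since |s_n| <= |t| + 1, this constant serves all [s_ n] at once, as the passage to the limit
   requires. *)
pose C := 5 * ((`|t| + 1) * DA + DB).
have ex n : exists m, gibbs_content (pot (s_ n)) (P (s_ n)) C m.
  have [m [mc mg]] := gibbs_content_exists i0
    (quasi_additive_potential (s_ n) qA qB) (hP (s_ n)).
  have EC : 5 * E (s_ n) <= C.
    rewrite /C /potential_bound ler_pM2l// lerD2r ler_wpM2r ?DA_ge0//.
    apply: le_trans (ler_normD _ _) _; rewrite lerD2l ger0_norm;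
      by case/andP: (a01 n) => // /ltW.
  exists m; split=> // w; have /andP[m1 m2] := mg w; apply/andP; split.
    by apply: le_trans m1; rewrite ler_expR; lra.
  by apply: le_trans m2 _; rewrite ler_expR; lra.
pose m_ n := sval (cid (ex n)).
have mg n : gibbs_content (pot (s_ n)) (P (s_ n)) C (m_ n) by rewrite /m_; case: cid.
have me k n : n%:R * e - DA <= word_mean A (m_ k) n.
  have [mc _] := mg k; have [j mj] := has_mean_exists mc qA.
  have := gibbs_subgradient t (mg k) mj; have := he _ (a01 k); rewrite -/(s_ k).
  have -> : t - s_ k = - k.+1%:R^-1 by rewrite /s_; ring.
  have /andP[+ _] := a01 k; move: (k.+1%:R^-1) => a a0 h1 h2.
  have : a * e <= a * j by lra.
  rewrite ler_pM2l// => /(ler_wpM2l (ler0n R n)) ej.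
  by have := mj n; rewrite ler_norml; lra.
have st : s_ n @[n --> \oo] --> t.
  suff : s_ n @[n --> \oo] --> t + 0 by rewrite addr0.
  by apply: cvgD; [exact: cvg_cst|exact: cvg_harmonic].
have [m g mean] := gibbs_limit st mg me.
have [mc _] := g; have [j mj] := has_mean_exists mc qA.
by exists m, C, j; split => //; exact: has_mean_ge mj mean.
Qed.

End family.
End potentials.

(** * The minimizer of the pressure and the derivative there *)

Section minimum.
Context {R : realType} {I : finType} (i0 : I).
Implicit Types (m phi A B : seq I -> R) (u v w : seq I) (n k : nat).

Definition grows_linearly A := exists2 e : R, 0 < e &
  forall N : nat, exists2 w, (N <= size w)%N & (size w)%:R * e <= A w.

(** A single word with large [A] bounds the partition function of its length from below, and such
    words occur at arbitrarily large lengths. *)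
Lemma pressure_coercive A B DA DB P :
  quasi_additive B DB -> pressure_family A B DA DB P ->
  grows_linearly A -> exists e b : R, 0 < e /\ forall s, 0 <= s -> s * e - b <= P s.
Proof.
move=> qB hP [e e0 up]; have [M M0 BM] := quasi_additive_linear qB.
exists e, M; split => // s s0; rewrite -subr_le0.
apply: (@le0_frequently _ _ (potential_bound DA DB s + DB)) => N.
have [w Nw Aw] := up N; exists (size w) => //.
have /andP[_ h] := hP s (size w).
have : expR (potential A B s w) <=
    expR ((size w)%:R * P s + potential_bound DA DB s).
  apply: le_trans h; apply: (ler_wsum_term (F := fun w => expR (potential A B s w))) => //.
rewrite ler_expR {1}/potential; have := ler_wpM2l s0 Aw.
by have := BM w; rewrite ler_norml; lra.
Qed.

Context {A B : seq I -> R} {DA DB : R} {P : R -> R}.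
Context (qA : quasi_additive A DA) (qB : quasi_additive B DB).
Context (hP : pressure_family A B DA DB P).

Local Notation pot := (potential A B).
Local Notation E := (potential_bound DA DB).

Lemma pressure_minimizer :
  grows_linearly A -> grows_linearly (fun w => - A w) ->
  exists t, forall s, P t <= P s.
Proof.
move=> up dn.
have [e1 [b1 [e10 h1]]] := pressure_coercive qB hP up.
have [e2 [b2 [e20 h2]]] := pressure_coercive qB (pressure_familyN hP) dn.
(* Outside [[-T, T]] coercivity gives values of at least [P 0], so a minimum over this interval is
   global. *)
pose T := Num.max 0 (Num.max ((P 0 + b1) / e1) ((P 0 + b2) / e2)).
have T0 : 0 <= T by rewrite /T le_max lexx.
have hT1 : (P 0 + b1) / e1 <= T by rewrite /T !le_max lexx !orbT.
have hT2 : (P 0 + b2) / e2 <= T by rewrite /T !le_max lexx !orbT.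
have [M M0 PM] := pressure_lipschitz qA hP.
have Pc : {within `[- T, T], continuous P}.
  apply: continuous_subspaceT => x; apply/cvgrPdist_le => d d0.
  have M1 : 0 < M + 1 by lra.
  have dM : 0 < d / (M + 1) by exact: divr_gt0.
  have := @cvgr_dist_le _ _ _ _ (nbhs_filter x) id x cvg_id _ dM.
  apply: filterS => y; rewrite ler_pdivlMr// => xy; apply: le_trans (PM _ _) _.
  by have := normr_ge0 (x - y); lra.
have TT : - T <= T by lra.
have [t tT Pt] := EVT_min TT Pc.
have P0 : P t <= P 0 by apply: Pt; rewrite in_itv/= oppr_le0 T0.
exists t => s; have [sT|] := boolP (s \in `[- T, T]); first exact: Pt.
rewrite in_itv/= negb_and -!ltNge => /orP[] sT; apply: (le_trans P0).
  have s0 : 0 <= - s by lra.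
  have := h2 _ s0; rewrite opprK.
  have : (P 0 + b2) / e2 <= - s by apply: le_trans hT2 _; lra.
  by rewrite ler_pdivrMr//; lra.
have s0 : 0 <= s by lra.
have := h1 _ s0.
have : (P 0 + b1) / e1 <= s by apply: le_trans hT1 _; lra.
by rewrite ler_pdivrMr//; lra.
Qed.

Lemma gibbs_left_limit (t e : R) :
  (forall a : R, 0 < a <= 1 -> P t + a * e <= P (t - a)) ->
  exists m C j, [/\ gibbs_content (pot t) (P t) C m, has_mean A DA m j & j <= - e].
Proof.
move=> he; have := @gibbs_right_limit _ _ i0 _ _ _ _ _ (quasi_additiveN qA) qB
  (pressure_familyN hP) (- t) e.
case=> [a /he|m [C [j [g mj ej]]]]; first by rewrite opprK opprD opprK.
exists m, C, (- j); split; last by rewrite lerN2.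
  move: g; rewrite opprK (_ : potential _ _ _ = pot t)//.
  by apply/funext => w; rewrite /potential mulrNN.
have := has_meanN mj; rewrite (_ : (fun w => - - A w) = A)//.
by apply/funext => w; rewrite opprK.
Qed.

(* At a minimizer the limits of the Gibbs contents from the right and from the left
   have means of opposite signs, and they coincide by uniqueness. *)
Lemma zero_mean_at_minimizer t : (forall s, P t <= P s) ->
  exists m C, gibbs_content (pot t) (P t) C m /\ has_mean A DA m 0.
Proof.
move=> tmin.
have [a _|m1 [C1 [j1 [g1 mj1 j1_ge]]]] := gibbs_right_limit i0 qA qB hP (t := t) (e := 0).
  by rewrite mulr0 addr0.
have [a _|m2 [C2 [j2 [g2 mj2 j2_le]]]] := @gibbs_left_limit t 0.
  by rewrite mulr0 addr0.
have m12 : m1 = m2.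
  by apply/funext; exact: gibbs_content_unique (quasi_additive_potential t qA qB) g1 g2.
exists m1, C1; split => //; rewrite m12 in mj1 *.
have j12 := has_mean_unique mj1 mj2; rewrite oppr0 -j12 in j2_le.
by rewrite (_ : 0 = j1)//; apply/eqP; rewrite eq_le j1_ge.
Qed.

(** If all difference quotients on one side stayed above [e], the limit of Gibbs contents from that
    side would have mean at least [e] or at most [- e], against uniqueness. *)
Lemma zero_mean_derivative t C m : gibbs_content (pot t) (P t) C m ->
  has_mean A DA m 0 -> forall e : R, 0 < e ->
  (exists2 a, 0 < a & P (t + a) <= P t + a * e) /\
  (exists2 a, 0 < a & P (t - a) <= P t + a * e).
Proof.
move=> g mj e e0; have qt := quasi_additive_potential t qA qB.
split; apply: contrapT => no.
  have [a /andP[a0 _]|m' [C' [j [g' mj' ej]]]] :=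
      gibbs_right_limit i0 qA qB hP (t := t) (e := e).
    by rewrite leNgt; apply/negP => /ltW h; apply: no; exists a.
  have mm : m' = m by apply/funext; exact: gibbs_content_unique qt g' g.
  by rewrite mm in mj'; move: ej; rewrite (has_mean_unique mj' mj) leNgt e0.
have [a /andP[a0 _]|m' [C' [j [g' mj' ej]]]] := @gibbs_left_limit t e.
  by rewrite leNgt; apply/negP => /ltW h; apply: no; exists a.
have mm : m' = m by apply/funext; exact: gibbs_content_unique qt g' g.
rewrite mm in mj'; move: ej; rewrite (has_mean_unique mj' mj) oppr_ge0 leNgt e0.
by [].
Qed.

End minimum.

(** * Recurrence *)

Section recurrence.
Context {R : realType} {I : finType} (i0 : I).
Implicit Types (m phi A B : seq I -> R) (u v w : seq I) (n k : nat).

(** Chernoff's bound with parameter [a]: the threshold [2 * e] against a pressure increase of at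
    most [a * e] leaves the rate [a * e]. *)
Lemma gibbs_upper_tail A B DA DB P t a e C m n :
  pressure_family A B DA DB P -> gibbs_content (potential A B t) (P t) C m ->
  0 < a -> P (t + a) <= P t + a * e ->
  wsum n (fun w => m w * (n%:R * (2 * e) < A w)%R%:R)
    <= expR (C + potential_bound DA DB (t + a) - n%:R * (a * e)).
Proof.
move=> hP [mc mg] a0 Pa.
have /andP[_ h] := hP (t + a) n.
apply: (@le_trans _ _ (expR (C - n%:R * P t - a * (n%:R * (2 * e))) *
    wsum n (fun w => expR (potential A B (t + a) w)))); last first.
  apply: le_trans (ler_wpM2l (expR_ge0 _) h) _.
  rewrite -expRD ler_expR; have := ler_wpM2l (ler0n R n) Pa; lra.
rewrite -wsumMl; apply: ler_wsum => w wn.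
case: ltP => [Aw|_]; last by rewrite mulr0 mulr_ge0// expR_ge0.
rewrite mulr1; have /andP[_ /le_trans] := mg w; apply.
rewrite -expRD ler_expR /potential wn.
by have := ler_wpM2l (ltW a0) (ltW Aw); lra.
Qed.

(** One quarter for each of the two tails leaves one half in the weak law. The 3 in the witness
    comes from 1 + y <= exp y. *)
Lemma expR_decay (c x : R) : 0 < x -> exists n0 : nat, forall n, (n0 <= n)%N ->
  expR (c - n%:R * x) <= 4^-1.
Proof.
move=> x0; exists (Num.bound (`|c + 3| / x)) => n n0.
have : `|c + 3| / x <= n%:R.
  apply: ltW; apply: lt_le_trans (archi_boundP _) _; first by rewrite divr_ge0// ltW.
  by rewrite ler_nat.
rewrite ler_pdivrMr// => h; have := le_trans (ler_norm _) h => {}h.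
have -> : c - n%:R * x = - (n%:R * x - c) by ring.
rewrite expRN lef_pV2 ?posrE ?expR_gt0//.
by apply: le_trans (expR_ge1Dx _); lra.
Qed.

Lemma gibbs_weak_lln A B DA DB P t C m (e : R) :
  quasi_additive A DA -> quasi_additive B DB -> pressure_family A B DA DB P ->
  gibbs_content (potential A B t) (P t) C m -> has_mean A DA m 0 -> 0 < e ->
  exists n0 : nat, forall n, (n0 <= n)%N ->
    2^-1 <= wsum n (fun w => m w * (`|A w| <= n%:R * e)%R%:R).
Proof.
move=> qA qB hP g mj e0; have e20 : 0 < e / 2 by rewrite divr_gt0.
have [[a a0 Pa] [b b0 Pb]] := zero_mean_derivative i0 qA qB hP g mj e20.
have [n1 h1] := expR_decay (C + potential_bound DA DB (t + a)) (mulr_gt0 a0 e20).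
have [n2 h2] := expR_decay (C + potential_bound DA DB (- t + b)) (mulr_gt0 b0 e20).
exists (maxn n1 n2) => n; rewrite geq_max => /andP[/h1 {}h1 /h2 {}h2].
have t1 := gibbs_upper_tail n hP g a0 Pa.
have g' : gibbs_content (potential (fun w => - A w) B (- t)) (P (- - t)) C m.
  rewrite opprK (_ : potential _ _ _ = potential A B t)//.
  by apply/funext => w; rewrite /potential mulrNN.
have Pb' : P (- (- t + b)) <= P (- - t) + b * (e / 2) by rewrite opprK opprD opprK.
have t2 := gibbs_upper_tail (P := fun s => P (- s)) n (pressure_familyN hP) g' b0 Pb'.
have {}t1 := le_trans t1 h1; have {}t2 := le_trans t2 h2.
have [mc _] := g; have := content_mass n mc.
have -> : wsum n m = wsum n (fun w => m w * (`|A w| <= n%:R * e)%R%:R) +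
    wsum n (fun w => m w * (~~ (`|A w| <= n%:R * e))%R%:R).
  rewrite -wsum_add; apply: eq_wsum => w _; rewrite -mulrDr -natrD.
  by case: (_ <= _); rewrite mulr1.
have : wsum n (fun w => m w * (~~ (`|A w| <= n%:R * e))%R%:R) <=
    wsum n (fun w => m w * (n%:R * (2 * (e / 2)) < A w)%R%:R) +
    wsum n (fun w => m w * (n%:R * (2 * (e / 2)) < - A w)%R%:R).
  rewrite -wsum_add; apply: ler_wsum => w _; rewrite -mulrDr -natrD.
  have [_ m0 _ _] := mc; rewrite ler_wpM2l// ler_nat (_ : 2 * (e / 2) = e); last by lra.
  rewrite -ltNge ltr_normr; case: (_ < _) => //=; case: (_ < _) => //.
lra.
Qed.

Lemma sum_ge_half (x : nat -> R) n0 N : (forall n, 0 <= x n) ->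
  (forall n, (n0 <= n < N)%N -> 2^-1 <= x n) ->
  (N%:R - n0%:R) / 2 <= \sum_(n < N) x n.
Proof.
move=> x0; elim: N => [_|N IH xN].
  by rewrite big_ord0 sub0r mulNr oppr_le0 divr_ge0.
rewrite big_ord_recr/=; have [n0N|Nn0] := leqP n0 N.
  have := xN N; rewrite n0N ltnSn => /(_ isT).
  rewrite -[N.+1%:R]natr1.
  have hh : forall n, (n0 <= n < N)%N -> 2^-1 <= x n.
    by move=> n /andP[h1 h2]; apply: xN; rewrite h1 ltnW.
  have := IH hh; lra.
apply: (@le_trans _ _ 0); last by rewrite addr_ge0// sumr_ge0.
by rewrite ler_pdivrMr// mul0r subr_le0 ler_nat.
Qed.

(* Each visit of [A] to a fixed interval of length [K - D] restarts, up to the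
   quasi-Bernoulli constant, a walk returning to the interval only if
   [`|A| <= K]; so finitely many expected returns would bound the expected
   occupation of every such interval, against the weak law of large numbers. *)
Lemma gibbs_recurrence A B DA DB P t C m (K : R) :
  quasi_additive A DA -> quasi_additive B DB -> pressure_family A B DA DB P ->
  gibbs_content (potential A B t) (P t) C m -> has_mean A DA m 0 ->
  (forall u v, A u + A v - DA <= A (u ++ v) <= A u + A v) -> DA < K ->
  forall U, exists N, U <
    \sum_(n < N) wsum n (fun w => m w * (`|A w| <= K)%R%:R).
Proof.
move=> qA qB hP g mj subA DK U; apply: contrapT => no.
have {no}HU N : \sum_(n < N) wsum n (fun w => m w * (`|A w| <= K)%R%:R) <= U.
  by rewrite leNgt; apply/negP => h; apply: no; exists N.
have [mc _] := g; have [m1 m0 mr _] := mc.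
have U0 : 0 <= U by have := HU 0%N; rewrite big_ord0.
pose kappa := expR (3 * C + potential_bound DA DB t).
have bern u v : m (u ++ v) <= kappa * m u * m v.
  by have /andP[] := gibbs_quasi_bernoulli u v (quasi_additive_potential t qA qB) g.
pose d := K - DA; have d0 : 0 < d by rewrite subr_gt0.
pose ind (a : R) w : R := (a <= A w <= a + d)%R%:R.
(* Given the prefix [u], the expected number of visits to [a, a + d] in [N] steps; the induction
   runs until the first visit. *)
have visits a N u : \sum_(j < N) wsum j (fun v => m (u ++ v) * ind a (u ++ v))
    <= kappa * U * m u.
  elim: N u => [|N IH] u; first by rewrite big_ord0 !mulr_ge0// expR_ge0.
  have [Au|nAu] := boolP (a <= A u <= a + d).
    have -> : kappa * U * m u = kappa * m u * U by ring.
    apply: le_trans (ler_wpM2l (mulr_ge0 (expR_ge0 _) (m0 u)) (HU N.+1)).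
    rewrite mulr_sumr; apply: ler_sum => j _; rewrite -wsumMl.
    apply: ler_wsum => v _; rewrite mulrA; apply: ler_pM => //.
    rewrite ler_nat; case: (boolP (a <= A (u ++ v) <= a + d)) => //= Auv.
    (* [A (u ++ v) - A u] has absolute value at most [d], and [A v] exceeds it by an amount in
       [0, DA], so K = d + DA suffices. *)
    rewrite (_ : `|A v| <= K)//; have := subA u v; move: Au Auv.
    by rewrite ler_norml /d; lra.
  (* No visit at [u] itself: its term vanishes, and the remaining ones are distributed over the next
     letter. *)
  rewrite big_ord_recl wsum0 cats0 /ind (negbTE nAu) mulr0 add0r -/(ind a).
  under eq_bigr do rewrite /= /bump/= add1n wsumS.
  rewrite exchange_big/= -mr mulr_sumr; apply: ler_sum => i _.
  apply: le_trans (IH (rcons u i)); apply: ler_sum => j _.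
  by apply: ler_wsum => v _; rewrite cat_rcons.
have m_ind0 w b : 0 <= m w * (b : bool)%:R by rewrite mulr_ge0.
(* The interval [-q d, q d] is covered by 2 q windows of length [d]; the additional 1 is the window
   used for q = 0. *)
have occupation q N :
    \sum_(n < N) wsum n (fun w => m w * (`|A w| <= q%:R * d)%R%:R)
      <= (2 * q%:R + 1) * (kappa * U).
  have v0 a := visits a N [::]; rewrite m1 mulr1 in v0.
  elim: q => [|q IH].
    rewrite mulr0 add0r mul1r; apply: le_trans (v0 0).
    apply: ler_sum => j _; apply: ler_wsum => w _; rewrite ler_wpM2l//.
    rewrite ler_nat mul0r normr_le0 /=; case: eqP => //= ->.
    by rewrite lexx add0r ltW.
  have := v0 (q%:R * d); have := v0 (- (q.+1%:R * d)).
  have : \sum_(n < N) wsum n (fun w => m w * (`|A w| <= q.+1%:R * d)%R%:R) <=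
     \sum_(n < N) wsum n (fun w => m w * (`|A w| <= q%:R * d)%R%:R) +
     \sum_(j < N) wsum j (fun v => m v * ind (q%:R * d) v) +
     \sum_(j < N) wsum j (fun v => m v * ind (- (q.+1%:R * d)) v).
    rewrite -!big_split/=; apply: ler_sum => j _; rewrite -!wsum_add.
    apply: ler_wsum => w _; rewrite -!mulrDr ler_wpM2l// -!natrD ler_nat.
    rewrite -[q.+1%:R]natr1 !ler_norml.
    case: (boolP (_ <= _ <= _)) => // h1.
    case: (boolP (_ <= _ <= _)) => //= h2.
    case: (boolP (_ <= _ <= _)) => //= h3.
    case: (boolP (_ <= _ <= _)) => //= h4; exfalso.
    move: h1 h2 h3 h4; rewrite !negb_and -!ltNge.
    move=> /andP[a1 a2] /orP[] b1 /orP[] b2 /orP[] b3; lra.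
  move: IH; rewrite -[q.+1%:R]natr1; lra.
pose H := kappa * U; have H0 : 0 <= H by rewrite mulr_ge0// expR_ge0.
(* In [r * q] steps with tolerance [d / r] the weak law gives an occupation of at least (r q - n0) /
   2. As r > 4 H + 2, comparison with (2 q + 1) H bounds [q], which is arbitrary. *)
pose r := (Num.bound (4 * H + 2)).
have rH : 4 * H + 2 < r%:R by apply: archi_boundP; lra.
have r0 : 0 < r%:R :> R by lra.
have [n0 lln] := gibbs_weak_lln qA qB hP g mj (divr_gt0 d0 r0).
have bad q : q%:R <= H + n0%:R / 2.
  have := occupation q (r * q)%N.
  have half : ((r * q)%:R - n0%:R) / 2 <=
      \sum_(n < (r * q)%N) wsum n (fun w => m w * (`|A w| <= q%:R * d)%R%:R).
    apply: (@sum_ge_half (fun n => wsum n _)) => [n|n /andP[n0n nr]].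
      exact: wsum_ge0.
    apply: le_trans (lln n n0n) _; apply: ler_wsum => w _.
    rewrite ler_wpM2l// ler_nat; case: (boolP (_ <= n%:R * _)) => // /le_trans -> //.
    rewrite mulrA ler_pdivrMr// mulrAC ler_wpM2r ?(ltW d0)//.
    by rewrite -natrM ler_nat mulnC ltnW.
  have hq : 2 * q%:R * H + q%:R <= r%:R * q%:R / 2.
    by have := ler_wpM2r (ler0n R q) (ltW rH); lra.
  by move: half; rewrite natrM -/H; lra.
have := bad (Num.bound (H + n0%:R / 2)); rewrite leNgt archi_boundP//.
by rewrite addr_ge0// divr_ge0.
Qed.

End recurrence.

(** * Shift-invariant measures from contents on words *)

Section shift_space_topology.
Context {R : realType} {I : finType} {i0 : I}.
Local Notation Sigma := (shift_space R i0).
Local Notation BSigma := (borel_shift_space R i0).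
Implicit Types (x y : Sigma) (u v w : seq I).

Lemma cylinderP w x : cylinder w x <-> forall j, (j < size w)%N -> x j = nth i0 w j.
Proof.
split=> [xw j jw|xw]; first by rewrite -xw nth_mkseq.
apply: (@eq_from_nth _ i0); rewrite size_mkseq// => j jw.
by rewrite nth_mkseq// xw.
Qed.

Lemma seq_dist_le n x y : (forall j, (j < n)%N -> x j = y j) ->
  seq_dist x y <= expR (- n%:R).
Proof.
move=> xy; rewrite -lee_fin seq_distE.
rewrite (_ : (expR (- n%:R))%:E = expeR (- n%:R%:E)%E)//.
rewrite lee_expeR leeN2; apply: ereal_sup_ubound.
by exists n.
Qed.

Lemma seq_dist_lt n x y : seq_dist x y < expR (- n%:R) ->
  forall j, (j < n)%N -> x j = y j.
Proof.
move=> d j jn; apply/eqP/negPn/negP => /eqP xy; move: d; rewrite ltNge => /negP; apply.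
rewrite -lee_fin seq_distE.
rewrite (_ : (expR (- n%:R))%:E = expeR (- n%:R%:E)%E)//.
rewrite lee_expeR leeN2; apply: ge_ereal_sup => _ [k kxy <-].
rewrite lee_fin ler_nat leqNgt; apply/negP => nk; apply: xy; apply: kxy.
exact: ltn_trans nk.
Qed.

Lemma cylinder_open w : open (cylinder w : set Sigma).
Proof.
rewrite openE => x /cylinderP xw; rewrite /interior -nbhs_ballE.
exists (expR (- (size w)%:R)); first exact: expR_gt0.
rewrite ballEmdist => y /= /seq_dist_lt xy; apply/cylinderP => j jw.
by rewrite -xy// xw.
Qed.

Lemma open_cylinder (U : set Sigma) x : open U -> U x ->
  exists n, cylinder (mkseq x n) `<=` U.
Proof.
rewrite openE => /[apply]; rewrite /interior -nbhs_ballE => -[e /= e0 xe].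
pose n := Num.bound (e^-1); exists n => y /cylinderP xy; apply: xe.
rewrite ballEmdist/=; apply: (@le_lt_trans _ _ (expR (- n%:R))).
  by apply: seq_dist_le => j jn; rewrite xy ?size_mkseq// nth_mkseq.
rewrite expRN invf_plt ?posrE ?expR_gt0//.
apply: (@lt_le_trans _ _ n%:R).
  by apply: archi_boundP; rewrite invr_ge0 ltW.
by apply: le_trans (expR_ge1Dx _); lra.
Qed.

Lemma cylinder_subset_open (U : set Sigma) :
  (forall x, U x -> exists n, cylinder (mkseq x n) `<=` U) -> open U.
Proof.
move=> hU; rewrite openE => x /hU[n nU]; rewrite /interior.
have := @cylinder_open (mkseq x n); rewrite openE => /(_ x).
rewrite /interior /cylinder/= size_mkseq => /(_ erefl).
by apply: filterS => y yx; apply: nU; rewrite /cylinder/= size_mkseq.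
Qed.

Lemma cylinderI u v : (size u <= size v)%N ->
  cylinder u `&` cylinder v = (cylinder v : set Sigma) \/
  cylinder u `&` cylinder v = (set0 : set Sigma).
Proof.
move=> uv; have [tv|ntv] := eqVneq (take (size u) v) u; [left|right].
  apply/seteqP; split=> [x []//|x xv]; split => //; apply/cylinderP => j ju.
  by move/cylinderP : xv => ->; [rewrite -tv nth_take|exact: leq_trans uv].
apply/seteqP; split => // x [/cylinderP xu /cylinderP xv].
move/eqP : ntv; apply; apply: (@eq_from_nth _ i0).
  by rewrite size_takel.
rewrite size_takel// => j ju; rewrite nth_take// -xu// xv//.
exact: leq_trans uv.
Qed.

(** The empty set is included to make the family closed under intersection. *)
Definition cylinders : set (set Sigma) :=
  [set A | A = set0 \/ exists w, A = cylinder w].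

Lemma cylinders_setI_closed : setI_closed cylinders.
Proof.
move=> A B [->|[u ->]] [->|[v ->]]; rewrite ?set0I ?setI0; [left|left|left|] => //.
have [uv|/ltnW uv] := leqP (size u) (size v).
  by have [->|->] := cylinderI uv; [right; exists v|left].
by rewrite setIC; have [->|->] := cylinderI uv; [right; exists u|left].
Qed.

(** There are countably many words, so an open set is the countable union of the cylinders it
    contains. *)
Lemma measurable_cylinders : (measurable : set (set BSigma)) = <<s cylinders >>.
Proof.
apply/seteqP; split; apply: smallest_sub.
- exact: smallest_sigma_algebra.
- move=> U oU; pose T := g_sigma_algebraType cylinders.
  have -> : U = \bigcup_(w : seq I)
      (if `[< @cylinder R I i0 w `<=` U >] then @cylinder R I i0 w else set0).
    apply/seteqP; split => [x Ux|x [w _]]; last by case: asboolP => // + xw; exact.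
    have [n nU] := open_cylinder oU Ux; exists (mkseq x n) => //.
    by case: asboolP => //= _; rewrite /cylinder/= size_mkseq.
  apply: (@countable_bigcupT_measurable _ T) => // w.
  case: asboolP => _; last exact: (@measurable0 _ T).
  by apply: sub_sigma_algebra; right; exists w.
- exact: smallest_sigma_algebra.
- move=> _ [->|[w ->]]; first exact: (@measurable0 _ BSigma).
  by apply: sub_sigma_algebra; exact: cylinder_open.
Qed.

Lemma cylinder_measurable w : measurable (cylinder w : set BSigma).
Proof. by rewrite measurable_cylinders; apply: sub_sigma_algebra; right; exists w. Qed.

Lemma borel_probability_unique (mu nu : probability BSigma R) :
  (forall w, mu (cylinder w) = nu (cylinder w)) ->
  forall A, measurable A -> mu A = nu A.
Proof.
move=> mn; apply: (@measure_unique _ _ BSigma cylinders (fun=> cylinder [::])).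
- exact: measurable_cylinders.
- exact: cylinders_setI_closed.
- by move=> _; right; exists [::].
- by apply/seteqP; split => // x _; exists 0%N.
- by move=> _ [->|[w ->]]; [rewrite !measure0|exact: mn].
- by move=> _; rewrite -ge0_fin_numE// fin_num_measure//; exact: cylinder_measurable.
Qed.

Lemma measurable_fun_cylinders d (T : measurableType d) (X : T -> BSigma) :
  (forall w, measurable (X @^-1` cylinder w)) -> measurable_fun setT X.
Proof.
move=> mX; apply: (@measurability _ _ T BSigma setT X cylinders); first exact: measurable_cylinders.
move=> _ [_ [->|[w ->]] <-]; rewrite setTI; first by rewrite preimage_set0.
exact: mX.
Qed.

Lemma measure_bigcup_fin d (T : measurableType d) (mu : probability T R)
    (J : finType) (F : J -> set T) :
  (forall j, measurable (F j)) -> trivIset setT F ->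
  (mu (\bigcup_j F j) = \sum_j mu (F j))%E.
Proof.
move=> mF tF; rewrite measure_fin_bigcup//; last exact: finite_finset.
rewrite (fsbigE (index_enum J)) ?index_enum_uniq// => [|i _].
  by apply: eq_bigl => i; rewrite in_setT.
by rewrite mem_index_enum.
Qed.

Lemma cylinder_disjoint n (F : I -> seq I) : (forall i, size (F i) = n) ->
  injective F -> trivIset setT (fun i => cylinder (F i) : set BSigma).
Proof.
by move=> Fn Finj i j _ _ [x []]; rewrite /cylinder/= !Fn => -> /Finj ->.
Qed.

Lemma cylinder_rcons w :
  (cylinder w : set BSigma) = \bigcup_i (cylinder (rcons w i) : set BSigma).
Proof.
apply/seteqP; split => [x xw|x [i _]].
  by exists (x (size w)) => //; rewrite /cylinder/= size_rcons mkseqS xw.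
by rewrite /cylinder/= size_rcons mkseqS => /rcons_inj[].
Qed.

Lemma shift_preimage_cylinder w :
  (Defs.shift : BSigma -> BSigma) @^-1` cylinder w =
  \bigcup_i (cylinder (i :: w) : set BSigma).
Proof.
have E (x : Sigma) n : mkseq x n.+1 = x 0%N :: mkseq (Defs.shift x) n.
  by rewrite /mkseq /= -[1%N]addn0 iotaDl -map_comp.
apply/seteqP; split => [x xw|x [i _]].
  by exists (x 0%N) => //; rewrite /cylinder/= E xw.
by rewrite /cylinder/= E => -[].
Qed.

Lemma shift_measurable : measurable_fun setT (Defs.shift : BSigma -> BSigma).
Proof.
apply: measurable_fun_cylinders => w; rewrite shift_preimage_cylinder.
apply: countable_bigcupT_measurable => [|i]; last exact: cylinder_measurable.
exact/finite_set_countable/finite_finset.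
Qed.

Context (mu : probability BSigma R).
Let m w := fine (mu (cylinder w)).

Lemma mu_fineK w : mu (cylinder w) = (m w)%:E.
Proof. by rewrite fineK// fin_num_measure//; exact: cylinder_measurable. Qed.

Lemma mu_rcons w : \sum_i m (rcons w i) = m w.
Proof.
apply: EFin_inj; rewrite -mu_fineK cylinder_rcons measure_bigcup_fin.
- by rewrite -sumEFin; apply: eq_bigr => i _; rewrite mu_fineK.
- by move=> i; exact: cylinder_measurable.
- by apply: (@cylinder_disjoint (size w).+1) => [i|i j /rcons_inj[]//]; rewrite size_rcons.
Qed.

Lemma mu_shift w : mu ((Defs.shift : BSigma -> BSigma) @^-1` cylinder w) = (\sum_i m (i :: w))%:E.
Proof.
rewrite shift_preimage_cylinder measure_bigcup_fin.
- by rewrite -sumEFin; apply: eq_bigr => i _; rewrite mu_fineK.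
- by move=> i; exact: cylinder_measurable.
- by apply: (@cylinder_disjoint (size w).+1) => // i j [].
Qed.

Lemma mu_nil : m [::] = 1.
Proof.
rewrite /m (_ : cylinder [::] = setT) ?probability_setT//.
by apply/seteqP; split.
Qed.

Lemma shift_invariant_content : shift_invariant mu -> word_content m.
Proof.
move=> inv; split; [exact: mu_nil|by move=> w; exact: fine_ge0|exact: mu_rcons|].
move=> w; apply: EFin_inj; rewrite -mu_shift inv ?mu_fineK//.
exact: cylinder_measurable.
Qed.

Lemma content_shift_invariant : word_content m -> shift_invariant mu.
Proof.
move=> [_ _ _ ml] A mA.
pose S : {mfun BSigma >-> BSigma} := mfun_Sub (mem_set shift_measurable).
apply: (borel_probability_unique (mu := distribution mu S) (nu := mu)) mA => w.
by rewrite mu_fineK -ml -mu_shift.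
Qed.

End shift_space_topology.

Lemma measurable_prop d (T : measurableType d) (p : Prop) :
  measurable [set _ : T | p].
Proof.
have [h|h] := pselect p.
  by rewrite (_ : [set _ | _] = setT)//; apply/seteqP; split.
by rewrite (_ : [set _ | _] = set0)//; apply/seteqP; split.
Qed.

(* [itv_start m w + [0, m w[] are nested half-open intervals: those of the words
   [rcons w i] partition that of [w].  Reading off the nested intervals that
   contain a uniform point of [0, 1[ yields a random sequence whose cylinder
   probabilities are the [m w]. *)
Section interval_coding.
Context {R : realType} {I : finType} (i0 : I) (m : seq I -> R).
Context (m1 : m [::] = 1) (m0 : forall w, 0 <= m w).
Context (mr : forall w, \sum_i m (rcons w i) = m w).
Local Notation Sigma := (shift_space R i0).
Local Notation BSigma := (borel_shift_space R i0).
Implicit Types (u v w : seq I) (r : R).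

(** The mass of the words of the same length that precede [w] lexicographically, the letters being
    ordered by [enum_rank]. *)
Definition itv_start w : R := \sum_(k < size w)
  \sum_(j | (enum_rank j < enum_rank (nth i0 w k))%N) m (rcons (take k w) j).

(** The rank [k] is a natural number so that the value [#|I|] can denote the right end of the
    interval of [w]. *)
Definition child_start w k : R :=
  itv_start w + \sum_(j | (enum_rank j < k)%N) m (rcons w j).

Definition in_itv_of w r := itv_start w <= r < itv_start w + m w.

Lemma itv_start_rcons w i : itv_start (rcons w i) = child_start w (enum_rank i).
Proof.
rewrite /itv_start size_rcons big_ord_recr/= nth_rcons ltnn eqxx.
rewrite -cats1 take_size_cat//; congr (_ + _); apply: eq_bigr => k _.
by rewrite nth_cat ltn_ord takel_cat// ltnW.
Qed.

Lemma child_start0 w : child_start w 0 = itv_start w.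
Proof. by rewrite /child_start big_pred0 ?addr0. Qed.

Lemma child_start_max w k : (#|I| <= k)%N -> child_start w k = itv_start w + m w.
Proof.
move=> Ik; rewrite /child_start -(mr w); congr (_ + _); apply: eq_bigl => j.
by rewrite (leq_trans (ltn_ord _)).
Qed.

Lemma child_start_mono w k l : (k <= l)%N -> child_start w k <= child_start w l.
Proof.
move=> kl; rewrite lerD2l [leRHS](bigID (fun j => (enum_rank j < k)%N))/=.
rewrite [X in _ <= X + _](eq_bigl (fun j => (enum_rank j < k)%N)) => [|j].
  by rewrite lerDl sumr_ge0.
by rewrite andb_idl// => /leq_trans; exact.
Qed.

Lemma child_startS w i : child_start w (enum_rank i).+1 =
  itv_start (rcons w i) + m (rcons w i).
Proof.
rewrite itv_start_rcons /child_start -addrA; congr (_ + _).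
rewrite (bigD1 i)//= addrC; congr (_ + _); apply: eq_bigl => j.
rewrite ltnS leq_eqVlt (inj_eq (@ord_inj _)) (inj_eq enum_rank_inj).
by case: eqVneq => [->|_]; rewrite ?ltnn ?andbT ?andbF.
Qed.

Lemma in_itv_child w r : in_itv_of w r -> exists i, in_itv_of (rcons w i) r.
Proof.
move=> /andP[r1 r2].
have ex : exists k, r < child_start w k by exists #|I|; rewrite child_start_max.
case: (ex_minnP ex) => -[|k]; first by rewrite child_start0 ltNge r1.
move=> rk kmin; have kI : (k < #|I|)%N.
  by apply: kmin; rewrite child_start_max.
exists (enum_val (Ordinal kI)).
rewrite /in_itv_of -child_startS itv_start_rcons enum_valK/= rk andbT.
by rewrite leNgt; apply/negP => /kmin; rewrite ltnn.
Qed.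

Lemma in_itv_parent w i r : in_itv_of (rcons w i) r -> in_itv_of w r.
Proof.
rewrite /in_itv_of -child_startS itv_start_rcons -(child_start_max w (leqnn _)).
rewrite -(child_start0 w) => /andP[r1 r2]; apply/andP; split.
  exact: le_trans (child_start_mono _ _) r1.
by apply: lt_le_trans r2 (child_start_mono _ _).
Qed.

Lemma in_itv_child_unique w i j r :
  in_itv_of (rcons w i) r -> in_itv_of (rcons w j) r -> i = j.
Proof.
rewrite /in_itv_of -!child_startS !itv_start_rcons => /andP[i1 i2] /andP[j1 j2].
apply: enum_rank_inj; apply: val_inj; apply/eqP; rewrite eqn_leq.
apply/andP; split; rewrite leqNgt; apply/negP => /(child_start_mono w).
  by rewrite leNgt (le_lt_trans i1 j2).
by rewrite leNgt (le_lt_trans j1 i2).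
Qed.

Fixpoint code_word r n : seq I := if n is n'.+1 then
  let w := code_word r n' in rcons w (odflt i0 [pick i | in_itv_of (rcons w i) r])
  else [::].

Definition code (r : measurableTypeR R) : BSigma := fun n => last i0 (code_word r n.+1).

Lemma mkseq_code r n : mkseq (code r) n = code_word r n.
Proof.
elim: n => [//|n IH]; rewrite mkseqS IH /= /code /=.
by rewrite last_rcons.
Qed.

Lemma code_word_in r n : in_itv_of [::] r -> in_itv_of (code_word r n) r.
Proof.
move=> r01; elim: n => [//|n /in_itv_child[i ri]] /=.
by case: pickP => [//|/(_ i)]; rewrite ri.
Qed.

Lemma code_word_unique r w : in_itv_of w r -> code_word r (size w) = w.
Proof.
elim/last_ind: w => [//|w i IH] rwi; rewrite size_rcons /=.
rewrite IH ?(in_itv_parent rwi)//; congr rcons; case: pickP => [j rj|/(_ i)] /=.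
  exact: in_itv_child_unique rj rwi.
by rewrite rwi.
Qed.

Lemma in_itv_nil w r : in_itv_of w r -> in_itv_of [::] r.
Proof. by elim/last_ind: w => // w i IH /in_itv_parent. Qed.

(** Outside [0, 1[ no child interval is ever found and the code is constantly [i0]; this accounts
    for the second set, which is null for the uniform law. *)
Lemma code_preimage w : code @^-1` cylinder w =
  `[itv_start w, itv_start w + m w[ `|`
  (~` `[0, 1[ `&` [set _ | nseq (size w) i0 = w]).
Proof.
have in01 r : in_itv_of [::] r = (r \in `[0, 1[).
  by rewrite /in_itv_of /itv_start big_ord0 m1 add0r in_itv.
have inw r : in_itv_of w r = (r \in `[itv_start w, itv_start w + m w[).
  by rewrite in_itv.
apply/seteqP; split => [r|r [|[/= r01 <-]]]; rewrite /cylinder/= mkseq_code.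
- move=> rw; have [r01|nr01] := boolP (in_itv_of [::] r).
    by left; rewrite /= -inw -rw; exact: code_word_in.
  right; split; first by rewrite /= -in01; exact/negP.
  rewrite /= -[RHS]rw; elim: (size w) => [//|n IH] /=.
  rewrite -IH; case: pickP => [j /in_itv_nil|_]; first by rewrite (negbTE nr01).
  by rewrite -cats1 -(nseqD n 1) addn1.
- by rewrite -inw; exact: code_word_unique.
- rewrite size_nseq; elim: (size w) => [//|n IH] /=.
  rewrite IH; case: pickP => [j /in_itv_nil|_]; first by rewrite in01 => /r01.
  by rewrite -cats1 -(nseqD n 1) addn1.
Qed.

Lemma code_measurable : measurable_fun setT code.
Proof.
apply: measurable_fun_cylinders => w; rewrite code_preimage.
apply: measurableU; first exact: measurable_itv.
apply: measurableI; last exact: measurable_prop.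
by apply: measurableC; exact: measurable_itv.
Qed.

Lemma itv_start_ge0 w : 0 <= itv_start w.
Proof. by rewrite sumr_ge0// => k _; rewrite sumr_ge0. Qed.

Lemma itv_end_le1 w : itv_start w + m w <= 1.
Proof.
elim/last_ind: w => [|w i IH]; first by rewrite m1 /itv_start big_ord0 add0r.
rewrite -child_startS; apply: le_trans IH; rewrite -(child_start_max w (leqnn _)).
by apply: child_start_mono.
Qed.

Let P : probability (measurableTypeR R) R := uniform_prob (@ltr01 R).

Lemma uniform_prob_sub (a b : R) : 0 <= a -> a <= b -> b <= 1 ->
  P `[a, b[%classic = (b - a)%:E.
Proof.
move=> a0 ab b1; rewrite /P/= /uniform_prob (eq_integral (fun=> 1%:E)).
  rewrite integral_cst//= mul1e lebesgue_measure_itv/= lte_fin.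
  by case: ltgtP ab => // -> _; rewrite subrr.
move=> x; rewrite inE/= in_itv/= => /andP[ax xb]; rewrite /uniform_pdf.
by rewrite (le_trans a0 ax) (le_trans (ltW xb) b1) subr0 invr1.
Qed.

Lemma word_content_probability : exists mu : probability BSigma R,
  forall w, mu (cylinder w) = (m w)%:E.
Proof.
pose X : {mfun measurableTypeR R >-> BSigma} := mfun_Sub (mem_set code_measurable).
exists (distribution P X) => w.
suff : P (code @^-1` cylinder w) = (m w)%:E by [].
have m01 : measurable (`[0, 1[%classic : set (measurableTypeR R)).
  exact: measurable_itv.
have P01 : P (~` `[0, 1[%classic) = 0%E.
  by rewrite probability_setC// uniform_prob_sub// subr0 subee.
have mS : measurable (~` `[0, 1[ `&` [set _ | nseq (size w) i0 = w]
    : set (measurableTypeR R)).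
  by apply: measurableI; [exact: measurableC|exact: measurable_prop].
rewrite code_preimage measureU0//.
- apply: etrans (uniform_prob_sub (itv_start_ge0 w) _ (itv_end_le1 w)) _.
    by rewrite lerDl.
  by rewrite addrC addKr.
- apply/eqP; rewrite eq_le measure_ge0 andbT -P01 measureIl//.
    exact: measurableC.
  exact: measurable_prop.
Qed.

End interval_coding.

(** * Word sums of Hoelder functions *)

Section birkhoff_sums.
Context {R : realType} {I : finType} {i0 : I}.
Local Notation Sigma := (shift_space R i0).
Implicit Types (f g : Sigma -> R) (x y : Sigma) (u v w : seq I) (n k : nat).

Lemma iter_shiftE n x : iter n Defs.shift x = (fun k => x (n + k)%N).
Proof.
elim: n => [//|n IH]; apply/funext => k.
by rewrite iterS IH /Defs.shift addSnnS.
Qed.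

Lemma birkhoffD f n k x :
  birkhoff f (n + k) x = birkhoff f n x + birkhoff f k (iter n Defs.shift x).
Proof.
rewrite /birkhoff big_split_ord/=; congr (_ + _); apply: eq_bigr => j _.
by rewrite addnC iterD.
Qed.

Lemma birkhoff_lin f g (s : R) n x :
  birkhoff (fun x => s * f x + g x) n x = s * birkhoff f n x + birkhoff g n x.
Proof. by rewrite /birkhoff big_split/= mulr_sumr. Qed.

Definition cat_word u y : Sigma :=
  fun n => if (n < size u)%N then nth i0 u n else y (n - size u)%N.

Lemma cylinder_cat_word u v y : cylinder v y -> cylinder (u ++ v) (cat_word u y).
Proof.
move=> /cylinderP yv; apply/cylinderP => j; rewrite size_cat => jn.
by rewrite nth_cat /cat_word; case: ltnP => // uj; rewrite yv// ltn_subLR.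
Qed.

Lemma shift_cat_word u y : iter (size u) Defs.shift (cat_word u y) = y.
Proof.
by rewrite iter_shiftE; apply/funext => k; rewrite /cat_word ltnNge leq_addr addKn.
Qed.

Lemma cylinder_catl u v x : cylinder (u ++ v) x -> cylinder u x.
Proof.
move=> /cylinderP xuv; apply/cylinderP => j ju.
by rewrite xuv ?nth_cat ?ju// size_cat ltn_addr.
Qed.

Lemma cylinder_catr u v x : cylinder (u ++ v) x ->
  cylinder v (iter (size u) Defs.shift x).
Proof.
move=> /cylinderP xuv; apply/cylinderP => j jv.
rewrite iter_shiftE xuv ?size_cat ?ltn_add2l//.
by rewrite nth_cat ltnNge leq_addr addKn.
Qed.

Definition word_point w : Sigma := nth i0 w.

Lemma cylinder_word_point w : cylinder w (word_point w).
Proof. exact/cylinderP. Qed.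

Lemma cylinder_mkseq n x : cylinder (mkseq x n) x.
Proof. by rewrite /cylinder/= size_mkseq. Qed.

Context {f : Sigma -> R} {D : R} (hD : distortion_constant f D).

Lemma distortion_ge0 : 0 <= D.
Proof.
have := hD (w := [::]) (cylinder_word_point [::]) (cylinder_word_point [::]).
by rewrite subrr normr0.
Qed.

Lemma word_sum_bounds w x : cylinder w x ->
  birkhoff f (size w) x <= word_sum f w <= birkhoff f (size w) x + D.
Proof.
move=> xw.
have ub : ubound [set birkhoff f (size w) y | y in cylinder w]
    (birkhoff f (size w) x + D).
  by move=> _ [y yw <-]; have := hD yw xw; rewrite ler_norml; lra.
apply/andP; split.
  by apply: ub_le_sup; [exists (birkhoff f (size w) x + D)|exists x].
by apply: ge_sup => //; exists (birkhoff f (size w) x), x.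
Qed.

(** A supremum of sums is at most the sum of suprema, so only the lower bound costs distortion. This
    one-sided error is what makes K > D enough for recurrence. *)
Lemma word_sum_cat u v : word_sum f u + word_sum f v - D <= word_sum f (u ++ v)
  <= word_sum f u + word_sum f v.
Proof.
apply/andP; split.
  suff : word_sum f v <= word_sum f (u ++ v) - word_sum f u + D by lra.
  apply: ge_sup.
    by exists (birkhoff f (size v) (word_point v)), (word_point v) => //;
      exact: cylinder_word_point.
  move=> _ [y yv <-]; have xw := cylinder_cat_word u yv.
  have /andP[+ _] := word_sum_bounds xw.
  rewrite size_cat birkhoffD shift_cat_word.
  by have /andP[_] := word_sum_bounds (cylinder_catl xw); lra.
apply: ge_sup.
  by exists (birkhoff f (size (u ++ v)) (word_point (u ++ v))),
    (word_point (u ++ v)) => //; exact: cylinder_word_point.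
move=> _ [x xuv <-]; rewrite size_cat birkhoffD lerD//.
  by have /andP[] := word_sum_bounds (cylinder_catl xuv).
by have /andP[] := word_sum_bounds (cylinder_catr xuv).
Qed.

Lemma word_sum_quasi_additive : quasi_additive (word_sum f) D.
Proof.
by move=> u v; have := word_sum_cat u v; have := distortion_ge0; rewrite ler_norml; lra.
Qed.

End birkhoff_sums.

(** * Bounded distortion of Hoelder functions *)

Section holder.
Context {R : realType} {I : finType} {i0 : I}.
Local Notation Sigma := (shift_space R i0).
Implicit Types (f : Sigma -> R) (x y : Sigma).

Lemma holder_variation f : holder_continuous f ->
  exists L q : R, [/\ 0 <= L, 0 < q, q < 1 &
    forall n x y, (forall j, (j < n)%N -> x j = y j) -> `|f x - f y| <= L * q ^+ n].
Proof.
move=> [a a0 [C fC]]; exists `|C|, (expR (- a)); split => //.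
- exact: expR_gt0.
- by rewrite expR_lt1 oppr_lt0.
move=> n x y xy; apply: le_trans (fC x y) _.
have d0 : 0 <= mdist x y `^ a by exact: powR_ge0.
apply: le_trans (ler_wpM2r d0 (ler_norm C)) _; rewrite ler_wpM2l//.
apply: (@le_trans _ _ (expR (- n%:R) `^ a)).
  rewrite ge0_ler_powR ?nnegrE ?expR_ge0 ?mdist_ge0 ?(ltW a0)//.
  exact: seq_dist_le xy.
by rewrite /powR gt_eqF ?expR_gt0// expRK -expRM_natl ler_expR; lra.
Qed.

Lemma holder_distortion f : holder_continuous f -> exists D, distortion_constant f D.
Proof.
move=> /holder_variation[L [q [L0 q0 q1 fL]]].
exists (L * (q / (1 - q))) => w x y /cylinderP xw /cylinderP yw.
have {xw yw} : forall j, (j < size w)%N -> x j = y j.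
  by move=> j jw; rewrite xw// yw.
have q1' : 0 < 1 - q by lra.
(* The induction needs the partial geometric sum q + ... + q^n: the orbit points agree on n, then n
   - 1, and finally 1 letter. *)
suff : (forall j, (j < size w)%N -> x j = y j) ->
    `|birkhoff f (size w) x - birkhoff f (size w) y| <=
    L * ((q - q ^+ (size w).+1) / (1 - q)).
  move=> /[apply] /le_trans; apply; rewrite ler_wpM2l// ler_pM2r ?invr_gt0//.
  by rewrite gerBl exprn_ge0// ltW.
elim: (size w) x y => [|n IH] x y xy.
  by rewrite /birkhoff !big_ord0 subrr normr0 expr1 subrr mul0r mulr0.
rewrite -[n.+1]add1n !birkhoffD /birkhoff !big_ord1 /=.
rewrite -!/(birkhoff _ _ _).
have h1 := fL n.+1 x y xy.
have h2 : `|birkhoff f n (Defs.shift x) - birkhoff f n (Defs.shift y)| <=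
    L * ((q - q ^+ n.+1) / (1 - q)).
  by apply: IH => j jn; rewrite /Defs.shift xy.
have -> : L * ((q - q ^+ (1 + n).+1) / (1 - q)) =
    L * q ^+ n.+1 + L * ((q - q ^+ n.+1) / (1 - q)).
  rewrite add1n [q ^+ n.+2]exprS; field; lra.
rewrite opprD addrACA; apply: le_trans (ler_normD _ _) _; exact: lerD.
Qed.

End holder.

(** * The classical pressure in terms of words *)

Section pressure_link.
Context {R : realType} {I : finType} {i0 : I}.
Local Notation Sigma := (shift_space R i0).
Implicit Types (f g psi : Sigma -> R) (J : {set I}).

Lemma pressure_onE g J p C :
  (forall n, `|ln (wsum n (fun w => expR (word_sum g w) * (all (mem J) w)%:R)) -
     n%:R * p| <= C) -> pressure_on g J = p.
Proof.
move=> h; rewrite /pressure_on; apply/cvg_lim => //.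
have := quasi_additive_cvg h; apply: cvg_trans; apply: near_eq_cvg.
near=> n; congr (_ * ln _); rewrite /wsum [RHS]big_mkcond/=.
by apply: eq_bigr => w _; case: ifP; rewrite ?mulr1 ?mulr0.
Unshelve. all: by end_near. Qed.

Lemma birkhoff_potential psi f D DB s w x : distortion_constant psi D ->
  distortion_constant f DB -> cylinder w x ->
  `|birkhoff (fun x => s * psi x + f x) (size w) x -
    potential (word_sum psi) (word_sum f) s w| <= potential_bound D DB s.
Proof.
move=> hD hDB xw; rewrite birkhoff_lin /potential /potential_bound.
have /andP[a1 a2] := word_sum_bounds hD xw.
have /andP[b1 b2] := word_sum_bounds hDB xw.
have -> : s * birkhoff psi (size w) x + birkhoff f (size w) x -
   (s * word_sum psi w + word_sum f w) =
   s * (birkhoff psi (size w) x - word_sum psi w) +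
   (birkhoff f (size w) x - word_sum f w) by ring.
apply: le_trans (ler_normD _ _) _; rewrite normrM lerD ?ler_wpM2l//;
  by rewrite ler_norml; apply/andP; split; lra.
Qed.

(** Word sums are suprema, possibly approached at different points for [psi] and [f], hence linear
    in [s] only up to distortion. *)
Lemma word_sum_potential psi f D DB s w : distortion_constant psi D ->
  distortion_constant f DB ->
  `|word_sum (fun x => s * psi x + f x) w -
    potential (word_sum psi) (word_sum f) s w| <= potential_bound D DB s.
Proof.
move=> hD hDB; have key x := @birkhoff_potential psi f D DB s w x hD hDB.
have xw := @cylinder_word_point R _ i0 w.
rewrite ler_norml; apply/andP; split.
  have := key _ xw; rewrite ler_norml => /andP[h _]; rewrite lerBrDr.
  apply: (le_trans (y := birkhoff (fun x => s * psi x + f x) (size w) (word_point w))).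
    lra.
  apply: ub_le_sup; last by exists (word_point w).
  exists (potential (word_sum psi) (word_sum f) s w + potential_bound D DB s).
  by move=> _ [y /key + <-]; rewrite ler_norml; lra.
rewrite lerBlDr; apply: ge_sup; first by eexists; exists (word_point w).
by move=> _ [y /key + <-]; rewrite ler_norml; lra.
Qed.

(** The potential has a pressure with error [E] by quasi-additivity. Passing to the true word sums
    doubles the error, which the limit defining [pressure] does not see. *)
Lemma pressure_word_family psi f D DB : distortion_constant psi D ->
  distortion_constant f DB ->
  pressure_family (word_sum psi) (word_sum f) D DB
    (fun s => pressure (fun x => s * psi x + f x)).
Proof.
move=> hD hDB s.
have qa := quasi_additive_potential s (word_sum_quasi_additive hD)
  (word_sum_quasi_additive hDB).
have [P hP] := quasi_additive_pressure i0 qa.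
suff -> : pressure (fun x => s * psi x + f x) = P by [].
set E := potential_bound D DB s in qa hP *.
pose g (x : Sigma) := s * psi x + f x; rewrite -/g.
apply: (@pressure_onE _ _ _ (E + E)) => n.
have -> : wsum n (fun w => expR (word_sum g w) * (all (mem [set: I]%SET) w)%:R) =
    wsum n (fun w => expR (word_sum g w)).
  apply: eq_wsum => w _; rewrite (_ : all _ w) ?mulr1//.
  by apply/allP => i _; rewrite inE.
have /andP[h1 h2] := hP n.
have Z0 : 0 < wsum n (fun w => expR (word_sum g w)) by exact: partition_gt0.
suff /andP[] : expR (n%:R * P - (E + E)) <= wsum n (fun w => expR (word_sum g w)) <=
    expR (n%:R * P + (E + E)).
  rewrite -{1 2}[wsum _ _](@lnK R) ?posrE// !ler_expR ler_norml => l1 l2.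
  by apply/andP; split; lra.
have gw w := word_sum_potential s w hD hDB.
apply/andP; split.
  apply: (@le_trans _ _ (expR (- E) *
    wsum n (fun w => expR (potential (word_sum psi) (word_sum f) s w)))).
    apply: le_trans (ler_wpM2l (expR_ge0 _) h1).
    by rewrite -expRD ler_expR; lra.
  rewrite -wsumMl; apply: ler_wsum => w _; rewrite -expRD ler_expR.
  by have := gw w; rewrite -/g -/E ler_norml; lra.
apply: (@le_trans _ _ (expR E *
    wsum n (fun w => expR (potential (word_sum psi) (word_sum f) s w)))).
  rewrite -wsumMl; apply: ler_wsum => w _; rewrite -expRD ler_expR.
  by have := gw w; rewrite -/g -/E ler_norml; lra.
apply: le_trans (ler_wpM2l (expR_ge0 _) h2) _.
by rewrite -expRD ler_expR; lra.
Qed.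

End pressure_link.

(** * Gibbs measures correspond to Gibbs contents *)

Section gibbs_measures.
Context {R : realType} {I : finType} {i0 : I}.
Local Notation Sigma := (shift_space R i0).
Local Notation BSigma := (borel_shift_space R i0).
Implicit Types (f psi : Sigma -> R) (x y : Sigma) (u v w : seq I) (n k : nat).
Implicit Types (mu nu : probability BSigma R).

Definition cylinder_content mu w : R := fine (mu (cylinder w)).

Lemma holder_measurable f : holder_continuous f ->
  measurable_fun (setT : set BSigma) f.
Proof.
move=> /holder_variation[L [q [L0 q0 q1 fL]]].
apply: (@measurability _ _ BSigma R setT f (@measurable_realfun.RGenOInfty.G R)).
  exact: measurable_realfun.RGenOInfty.measurableE.
move=> _ [_ [a ->] <-]; rewrite setTI; apply: sub_sigma_algebra.
apply: cylinder_subset_open => x /=; rewrite in_itv/= andbT => ax.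
have d0 : 0 < (f x - a) / (L + 1) by rewrite divr_gt0//; lra.
have : q ^+ n @[n --> \oo] --> (0 : R) by apply: cvg_expr; rewrite ger0_norm// ltW.
move=> /cvgrPdist_lt /(_ _ d0) /(@filter_ex _ _ _ _)[n].
rewrite sub0r normrN ger0_norm; last by rewrite exprn_ge0// ltW.
rewrite ltr_pdivlMr; last lra.
move=> qn; exists n => y /cylinderP yx.
rewrite /= in_itv/= andbT; have fxy := fL n x y.
have /fxy : forall j, (j < n)%N -> x j = y j.
  by move=> j jn; rewrite yx ?size_mkseq// nth_mkseq.
have : 0 <= q ^+ n by rewrite exprn_ge0// ltW.
by rewrite ler_norml; lra.
Qed.

Lemma distortion_bounded f D : distortion_constant f D ->
  exists M, forall x, `|f x| <= M.
Proof.
move=> fD; exists (\sum_i `|f (word_point [:: i])| + D) => x.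
have xx : cylinder [:: x 0%N] x by [].
have := fD _ x (word_point [:: x 0%N]) xx (cylinder_word_point _).
rewrite /birkhoff !big_ord1/=.
have : `|f (word_point [:: x 0%N])| <= \sum_i `|f (word_point [:: i])|.
  by rewrite (bigD1 (x 0%N))//= lerDl sumr_ge0.
by rewrite !ler_norml; lra.
Qed.

Lemma holder_integrable f mu : holder_continuous f ->
  mu.-integrable setT (EFin \o f).
Proof.
move=> hf; have [D /distortion_bounded[M fM]] := holder_distortion hf.
apply: measurable_bounded_integrable => //.
- by rewrite -ge0_fin_numE// fin_num_measure.
- exact: holder_measurable.
- exists M; split; first exact: num_real.
  by move=> N MN x _; exact: le_trans (fM x) (ltW MN).
Qed.

Lemma shift_iter_invariant mu k A : shift_invariant mu -> measurable A ->
  measurable ((iter k Defs.shift : BSigma -> BSigma) @^-1` A) /\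
  mu ((iter k Defs.shift : BSigma -> BSigma) @^-1` A) = mu A.
Proof.
move=> inv mA; elim: k => [//|k [mk IH]].
have mk1 : measurable ((Defs.shift : BSigma -> BSigma) @^-1`
    (iter k Defs.shift @^-1` A)).
  by rewrite -[X in measurable X]setTI; exact: shift_measurable.
have -> : (iter k.+1 Defs.shift : BSigma -> BSigma) @^-1` A =
    (Defs.shift : BSigma -> BSigma) @^-1` (iter k Defs.shift @^-1` A).
  by apply/seteqP; split=> x /=; rewrite -iterS iterSr.
by split => //; rewrite inv.
Qed.

Lemma integral_shift f mu k : holder_continuous f -> shift_invariant mu ->
  mu.-integrable setT (EFin \o (fun x => f (iter k Defs.shift x))) /\
  (\int[mu]_x (f (iter k Defs.shift x))%:E = \int[mu]_x (f x)%:E)%E.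
Proof.
move=> hf inv.
have mk : measurable_fun setT (iter k Defs.shift : BSigma -> BSigma).
  by move=> _ A mA; rewrite setTI; have [] := shift_iter_invariant k inv mA.
have [D /distortion_bounded[M fM]] := holder_distortion hf.
have ik : mu.-integrable setT (EFin \o (fun x => f (iter k Defs.shift x))).
  apply: measurable_bounded_integrable => //.
  - by rewrite -ge0_fin_numE// fin_num_measure.
  - by apply: (measurableT_comp (holder_measurable hf) mk).
  - exists M; split; first exact: num_real.
    by move=> N MN x _; exact: le_trans (fM _) (ltW MN).
split => //.
have := @integral_pushforward _ _ BSigma BSigma R _ mk mu setT (EFin \o f).
rewrite preimage_setT => /(_ _ ik measurableT) <-.
  apply: eq_measure_integral => A mA _ /=.
  by have [_ <-] := shift_iter_invariant k inv mA.
by apply/measurable_realfun.measurable_EFinP; exact: holder_measurable.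
Qed.

(** The Birkhoff sum, whose integral is [n * j] by invariance, and the step function of word sums,
    whose integral is the word mean, differ by an amount in [0, D]. *)
Lemma integral_has_mean f D mu : holder_continuous f -> distortion_constant f D ->
  shift_invariant mu -> exists2 j, (\int[mu]_x (f x)%:E)%E = j%:E &
    has_mean (word_sum f) D (cylinder_content mu) j.
Proof.
move=> hf fD inv.
have [j fj] : exists j, (\int[mu]_x (f x)%:E)%E = j%:E.
  exists (fine (\int[mu]_x (f x)%:E)%E); rewrite fineK//.
  exact: integrable_fin_num (holder_integrable mu hf).
exists j => // n; set A := word_sum f.
have bI : mu.-integrable setT (EFin \o birkhoff f n).
  rewrite (_ : _ \o _ = fun x => (\sum_(k < n) (f (iter k Defs.shift x))%:E)%E).
    by apply: integrable_sum => // k _; exact: (integral_shift k hf inv).1.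
  by apply/funext => x; rewrite /= -sumEFin.
have bE : (\int[mu]_x (birkhoff f n x)%:E)%E = (n%:R * j)%:E.
  under eq_integral do rewrite /birkhoff -sumEFin.
  rewrite (integral_sum measurableT (fun k : 'I_n => (integral_shift k hf inv).1)).
  rewrite (eq_bigr (fun=> j%:E)) => [|k _]; last first.
    by rewrite (integral_shift k hf inv).2 fj.
  by rewrite sumEFin sumr_const card_ord mulr_natl.
pose step x := \sum_(w : n.-tuple I) A w * \1_(cylinder w : set BSigma) x.
have stepE x : step x = A (mkseq x n).
  have sz : size (mkseq x n) == n by rewrite size_mkseq.
  rewrite /step (bigD1 (Tuple sz))//= indicE mem_set ?mulr1; last first.
    exact: cylinder_mkseq.
  rewrite big1 ?addr0// => w /eqP wx; rewrite indicE memNset ?mulr0// => xw.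
  by apply: wx; apply: val_inj; rewrite /= -xw size_tuple.
have iI (w : seq I) : mu.-integrable setT
    (fun x => (A w * \1_(cylinder w : set BSigma) x)%:E).
  have := integrableZl measurableT (A w) (integrable_indic mu (cylinder_measurable w)).
  by under eq_fun do rewrite -EFinM.
have sI : mu.-integrable setT (EFin \o step).
  rewrite (_ : _ \o _ = fun x => (\sum_(w : n.-tuple I)
      (A w * \1_(cylinder w : set BSigma) x)%:E)%E).
    by apply: integrable_sum => // w _; exact: iI.
  by apply/funext => x; rewrite /= -sumEFin.
have sE : (\int[mu]_x (step x)%:E)%E = (word_mean A (cylinder_content mu) n)%:E.
  under eq_integral do rewrite /step -sumEFin.
  rewrite (integral_sum measurableT (fun w : n.-tuple I => iI w)).
  rewrite -sumEFin; apply: eq_bigr => w _.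
  under eq_integral do rewrite EFinM.
  rewrite integralZl//; last exact: integrable_indic (cylinder_measurable w).
  rewrite integral_indic//; last exact: cylinder_measurable.
  rewrite setIT mulrC EFinM; congr (_ * _)%E; exact: mu_fineK.
have bs x : birkhoff f n x <= step x <= birkhoff f n x + D.
  rewrite stepE; have := word_sum_bounds fD (cylinder_mkseq n x).
  by rewrite size_mkseq.
rewrite ler_norml; apply/andP; split.
  have : n%:R * j <= word_mean A (cylinder_content mu) n.
    rewrite -lee_fin -bE -sE; apply: le_integral => // x _.
    by rewrite lee_fin; case/andP: (bs x).
  by have := distortion_ge0 fD; lra.
rewrite lerBlDr addrC -lee_fin EFinD -bE -sE.
have Dint : mu.-integrable setT (EFin \o cst D).
  exact: finite_measure_integrable_cst.
rewrite (_ : D%:E = \int[mu]_x D%:E)%E; last first.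
  rewrite integral_cst// -[LHS]mule1; congr (_ * _)%E.
  exact/esym/probability_setT.
rewrite -integralD//; apply: le_integral => //; first exact: integrableD.
by move=> x _; rewrite -EFinD lee_fin; case/andP: (bs x).
Qed.

Context {psi f : Sigma -> R} {D DB : R}.
Context (hD : distortion_constant psi D) (hDB : distortion_constant f DB).

Local Notation g s := (fun x : Sigma => s * psi x + f x).
Local Notation pot s := (potential (word_sum psi) (word_sum f) s).
Local Notation E s := (potential_bound D DB s).

Lemma gibbs_property_content s mu : shift_invariant mu -> gibbs_property (g s) mu ->
  exists C, gibbs_content (pot s) (pressure (g s)) C (cylinder_content mu).
Proof.
move=> inv [c c1 gb]; exists (ln c + E s).
have c0 : 0 < c by lra.
split; first exact: shift_invariant_content.
move=> w; have xw := @cylinder_word_point R _ i0 w.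
have := gb w _ xw; have := birkhoff_potential s hD hDB xw.
set b := birkhoff _ _ _; rewrite (mu_fineK mu w) -/(cylinder_content mu w).
rewrite -EFinM !lee_fin ler_norml => /andP[b1 b2].
rewrite ler_pdivlMr ?expR_gt0// ler_pdivrMr ?expR_gt0// => /andP[m1 m2].
apply/andP; split.
  apply: le_trans m1; rewrite -{2}(@lnK _ c) ?posrE// -expRN -expRD ler_expR; lra.
by apply: le_trans m2 _; rewrite -{1}(@lnK _ c) ?posrE// -expRD ler_expR; lra.
Qed.

Lemma gibbs_content_measure s C m :
  gibbs_content (pot s) (pressure (g s)) C m ->
  exists2 mu, is_gibbs_measure (g s) mu & cylinder_content mu = m.
Proof.
move=> gm; have [mc mb] := gm; have [m1 m0 mr ml] := mc.
have [mu muE] := word_content_probability i0 m1 m0 mr.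
have mum : cylinder_content mu = m.
  by apply/funext => w; rewrite /cylinder_content muE.
have inv : shift_invariant mu.
  by apply: content_shift_invariant; rewrite -/(cylinder_content mu) mum.
exists mu => //; split => //.
  have E0 : 0 <= E s.
    by rewrite addr_ge0 ?mulr_ge0 ?(distortion_ge0 hD) ?(distortion_ge0 hDB).
  (* The absolute value secures a constant of at least 1. *)
  exists (expR (`|C| + E s)).
    by rewrite -expR0 ler_expR addr_ge0.
  move=> w x xw; rewrite muE -EFinM !lee_fin.
  have := birkhoff_potential s hD hDB xw; rewrite ler_norml => /andP[b1 b2].
  have /andP[h1 h2] := mb w.
  have := ler_norm C; have := ler_norm (- C); rewrite normrN => C1 C2.
  rewrite ler_pdivlMr ?expR_gt0// ler_pdivrMr ?expR_gt0// -expRN -!expRD.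
  apply/andP; split; first by apply: le_trans h1; rewrite ler_expR; lra.
  by apply: le_trans h2 _; rewrite ler_expR; lra.
move=> nu inv' gb'; apply: borel_probability_unique => w.
have [C' gm'] := gibbs_property_content inv' gb'.
have qa := quasi_additive_potential s (word_sum_quasi_additive hD)
  (word_sum_quasi_additive hDB).
rewrite muE (mu_fineK nu w) -/(cylinder_content nu w).
by rewrite (gibbs_content_unique qa gm' gm).
Qed.

End gibbs_measures.

(** * Fibre-induced pressure *)

Section limsup.
Context {R : realType}.
Implicit Types (u : (\bar R)^nat) (c : \bar R).

Lemma limn_esup_le u c : (\forall n \near \oo, (u n <= c)%E) -> (limn_esup u <= c)%E.
Proof.
move=> uc; apply: (@le_trans _ _ (ereal_sup [set u n | n in [set n | (u n <= c)%E]])).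
  by apply: ereal_inf_lbound; exists [set n | (u n <= c)%E].
by apply: ge_ereal_sup => _ [n /= ? <-].
Qed.

Lemma limn_esup_ge u c : (forall N : nat, exists2 n, (N <= n)%N & (c <= u n)%E) ->
  (c <= limn_esup u)%E.
Proof.
move=> uc; apply: le_ereal_inf_tmp => _ [V [N _ NV] <-].
have [n Nn cn] := uc N; apply: le_trans cn _; apply: ereal_sup_ubound.
by exists n => //; exact: NV.
Qed.

Lemma limn_esup_lt u c : (limn_esup u < c)%E -> \forall n \near \oo, (u n < c)%E.
Proof.
move=> /ereal_inf_lt[_ [V oV <-] Vc]; apply: filterS oV => n Vn.
by apply: le_lt_trans Vc; apply: ereal_sup_ubound; exists n.
Qed.

Lemma limn_esup_gt0 u : (0 < limn_esup u)%E -> exists2 e : R, 0 < e &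
  forall N : nat, exists2 n, (N <= n)%N & (e%:E <= u n)%E.
Proof.
move=> u0; apply: contrapT => no; move: u0; rewrite ltNge => /negP; apply.
apply/lee_addgt0Pr => e e0; rewrite add0e; apply: limn_esup_le.
apply: contrapT => noe; apply: no; exists e => // N; apply: contrapT => noN.
apply: noe; exists N => // n Nn /=; rewrite leNgt; apply/negP => /ltW h.
by apply: noN; exists n.
Qed.

Definition growth (X : nat -> R) : \bar R :=
  limn_esup (fun n => (n%:R^-1)%:E * lne (X n)%:E)%E.

(** The convention [lne x = -oo] for [x <= 0] makes the equivalence valid also when no word is
    counted. *)
Lemma growth_term_le n (x r : R) : (0 < n)%N ->
  ((n%:R^-1)%:E * lne x%:E <= r%:E)%E = (x <= expR (n%:R * r)).
Proof.
move=> n0; have n0' : 0 < n%:R^-1 :> R by rewrite invr_gt0 ltr0n.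
have [x0|x0] := leP x 0.
  have -> : lne x%:E = -oo%E by rewrite /lne x0.
  by rewrite gt0_muleNy ?lte_fin// leNye (le_trans x0 (expR_ge0 _)).
rewrite lne_EFin// -EFinM lee_fin ler_pdivrMl ?ltr0n//.
by rewrite -{2}(@lnK _ x) ?posrE// ler_expR.
Qed.

Lemma growth_term_ge n (x r : R) : (0 < n)%N ->
  (r%:E <= (n%:R^-1)%:E * lne x%:E)%E = (expR (n%:R * r) <= x).
Proof.
move=> n0; have n0' : 0 < n%:R^-1 :> R by rewrite invr_gt0 ltr0n.
have [x0|x0] := leP x 0.
  have -> : lne x%:E = -oo%E by rewrite /lne x0.
  rewrite gt0_muleNy ?lte_fin// leeNy_eq/=; apply/esym/negbTE.
  by rewrite -ltNge (le_lt_trans x0 (expR_gt0 _)).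
rewrite lne_EFin// -EFinM lee_fin ler_pdivlMl ?ltr0n//.
by rewrite -{2}(@lnK _ x) ?posrE// ler_expR.
Qed.

Lemma growth_le X (p C : R) : (forall n, X n <= expR (n%:R * p + C)) ->
  (growth X <= p%:E)%E.
Proof.
move=> XC; apply/lee_addgt0Pr => e e0; apply: limn_esup_le; near=> n.
have n0 : (0 < n)%N by near: n; exact: nbhs_infty_gt.
rewrite -EFinD growth_term_le//; apply: (le_trans (XC n)); rewrite ler_expR.
have : C / e <= n%:R by near: n; exact: nbhs_infty_ger.
by rewrite ler_pdivrMr//; lra.
Unshelve. all: by end_near. Qed.

Lemma growth_ge X (p C : R) : (forall n, expR (n%:R * p - C) <= X n) ->
  (p%:E <= growth X)%E.
Proof.
move=> XC; apply/lee_addgt0Pr => e e0.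
rewrite -leeBlDr// -EFinB; apply: limn_esup_ge => N.
pose n := maxn N.+1 (Num.bound `|C / e|); exists n; first by rewrite leq_max leqnSn.
rewrite growth_term_ge ?leq_max//; apply: le_trans (XC n); rewrite ler_expR.
have : C / e <= n%:R.
  apply: le_trans (ler_norm _) (le_trans (ltW (archi_boundP _)) _) => //.
  by rewrite ler_nat leq_max leqnn orbT.
by rewrite ler_pdivrMr//; lra.
Qed.

Lemma growth_Ny X N : (forall n, (N <= n)%N -> X n = 0) -> growth X = -oo%E.
Proof.
move=> X0; apply/eqP; rewrite -leeNy_eq; apply: limn_esup_le; near=> n.
rewrite X0; last by near: n; exact: nbhs_infty_ge.
rewrite (_ : lne 0%:E = -oo%E); last by rewrite /lne lexx.
rewrite gt0_muleNy// lte_fin invr_gt0 ltr0n.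
by near: n; exact: nbhs_infty_gt.
Unshelve. all: by end_near. Qed.

Lemma growth_lt X (p : R) : (growth X < p%:E)%E -> exists2 r, r < p &
  exists N : nat, forall n, (N <= n)%N -> X n <= expR (n%:R * r).
Proof.
move=> Xp; have [r rp Xr] : exists2 r : R, r < p & (growth X < r%:E)%E.
  move: Xp; case: (growth X) => [x|//|].
    rewrite lte_fin => xp; exists ((x + p) / 2); first lra.
    by rewrite lte_fin; lra.
  by move=> _; exists (p - 1); [lra|rewrite ltNyr].
exists r => //; have [N _ NX] := limn_esup_lt Xr.
exists N.+1 => n Nn; rewrite -growth_term_le ?(leq_trans _ Nn)//.
by apply/ltW/NX; rewrite /= ltnW.
Qed.

End limsup.

Section mean_growth.
Context {R : realType} {I : finType} {i0 : I} {psi : shift_space R i0 -> R} {D : R}.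
Context (hD : distortion_constant psi D).

Lemma upper_mean_gt0 : (0 < upper_mean psi)%E -> grows_linearly (word_sum psi).
Proof.
move=> /ereal_sup_gt[_ [x _ <-]] /limn_esup_gt0[e e0 he]; exists e => // N.
have [n Nn en] := he N.+1; exists (mkseq x n); first by rewrite size_mkseq ltnW.
have n0 : (0 : R) < n%:R by rewrite ltr0n (leq_trans _ Nn).
have /andP[+ _] := word_sum_bounds hD (cylinder_mkseq n x).
rewrite size_mkseq; apply: le_trans.
by move: en; rewrite lee_fin ler_pdivlMr// mulrC.
Qed.

Lemma lower_mean_lt0 : (lower_mean psi < 0)%E ->
  grows_linearly (fun w => - word_sum psi w).
Proof.
move=> /ereal_inf_lt[_ [x _ <-]]; rewrite /limn_einf oppe_lt0.
(* A word sum may exceed the Birkhoff sum by [D]; half of the rate is given up to absorb it at large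
   lengths. *)
move=> /limn_esup_gt0[e e0 he]; have e20 : 0 < e / 2 by rewrite divr_gt0.
exists (e / 2) => // N.
have [n] := he (maxn N.+1 (Num.bound `|D / (e / 2)|)).
rewrite geq_max => /andP[Nn Dn]; rewrite -EFinN lee_fin lerNr => hn.
exists (mkseq x n); first by rewrite size_mkseq ltnW.
have n0 : (0 : R) < n%:R by rewrite ltr0n (leq_trans _ Nn).
have /andP[_ +] := word_sum_bounds hD (cylinder_mkseq n x).
move: hn; rewrite size_mkseq ler_pdivrMr//.
have : D / (e / 2) <= n%:R.
  apply: le_trans (ler_norm _) (le_trans (ltW (archi_boundP _)) _) => //.
  by rewrite ler_nat.
by rewrite ler_pdivrMr//; lra.
Qed.

Lemma lower_le_upper_mean : (lower_mean psi <= upper_mean psi)%E.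
Proof.
pose x : shift_space R i0 := fun=> i0.
apply: (@le_trans _ _ (limn_einf (fun n => (birkhoff psi n x / n%:R)%:E))).
  by apply: ereal_inf_lbound; exists x.
apply: le_trans (limn_einf_sup _) _.
by apply: ereal_sup_ubound; exists x.
Qed.

End mean_growth.

(** * Divergent sums over words *)

Section divergence.
Context {R : realType} {I : finType}.
Implicit Types (w : seq I).

Fixpoint words_lt N : seq (seq I) := if N is n.+1
  then words_lt n ++ map val (enum {: n.-tuple I}) else [::].

Lemma words_lt_size N w : w \in words_lt N -> (size w < N)%N.
Proof.
elim: N => // N IH; rewrite mem_cat => /orP[/IH/ltnW//|/mapP[v _ ->]].
by rewrite size_tuple.
Qed.

Lemma words_lt_uniq N : uniq (words_lt N).
Proof.
elim: N => // N IH /=; rewrite cat_uniq IH map_inj_uniq; last exact: val_inj.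
rewrite enum_uniq andbT; apply/hasPn => _ /mapP[v _ ->].
by apply/negP => /words_lt_size; rewrite /= size_tuple ltnn.
Qed.

Lemma sum_words_lt N (x : seq I -> R) :
  \sum_(w <- words_lt N) x w = \sum_(n < N) wsum n x.
Proof.
elim: N => [|N IH]; first by rewrite big_nil big_ord0.
by rewrite /= big_cat IH big_ord_recr/= big_map big_enum.
Qed.

Lemma esum_words_infty (S : set (seq I)) (a : seq I -> \bar R) (x : seq I -> R) :
  (forall w, S w -> ((x w)%:E <= a w)%E) -> (forall w, ~ S w -> x w = 0) ->
  (forall U, exists N, U < \sum_(n < N) wsum n x) ->
  (\esum_(w in S) a w = +oo)%E.
Proof.
move=> xa x0 xU; apply/eqyP => U U0; apply: esum_ge.
have [N hN] := xU U.
pose r := [seq w <- words_lt N | `[< S w >]].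
exists [set` r].
  split; first exact: finite_seq.
  by move=> w /=; rewrite mem_filter => /andP[/asboolP].
rewrite -fsbig_seq ?filter_uniq ?words_lt_uniq// big_filter.
apply: (@le_trans _ _ (\sum_(w <- words_lt N | `[< S w >]) (x w)%:E)%E); last first.
  by apply: lee_sum => w /asboolP; exact: xa.
rewrite sumEFin lee_fin (le_trans (ltW hN))// -sum_words_lt.
rewrite [leLHS](bigID (fun w => `[< S w >]))/= [X in _ + X]big1 ?addr0//.
by move=> w /asboolPn/x0.
Qed.

Lemma geometric_sum_bounded (x : nat -> R) (c q : R) N0 : 0 <= q -> q < 1 ->
  0 <= c -> (forall n, 0 <= x n <= 1) ->
  (forall n, (N0 <= n)%N -> x n <= c * q ^+ n) ->
  forall N, \sum_(n < N) x n <= N0%:R + c / (1 - q).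
Proof.
move=> q0 q1 c0 x01 xq N; have q1' : 0 < 1 - q by lra.
(* Each term before [N0] is charged 1, the later ones their share of the geometric series. *)
suff : \sum_(n < N) x n <= (minn N N0)%:R + c * (1 - q ^+ N) / (1 - q).
  move=> /le_trans; apply; apply: lerD; first by rewrite ler_nat geq_minr.
  rewrite ler_wpM2r ?invr_ge0 ?(ltW q1')// ler_piMr// gerBl exprn_ge0//.
elim: N => [|N IH].
  by rewrite big_ord0 min0n expr0 subrr mulr0 mul0r addr0.
rewrite big_ord_recr/=; apply: le_trans (lerD IH (lexx _)) _.
have -> : c * (1 - q ^+ N.+1) / (1 - q) = c * (1 - q ^+ N) / (1 - q) + c * q ^+ N.
  by rewrite exprS; field; lra.
have cq : 0 <= c * q ^+ N by rewrite mulr_ge0// exprn_ge0.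
have [N0N|NN0] := leqP N0 N.
  rewrite (minn_idPr (leqW N0N)); have := xq _ N0N; lra.
rewrite (minn_idPl NN0) -[N.+1%:R]natr1.
have /andP[_] := x01 N; lra.
Qed.

End divergence.

Section fibre_pressure_bounds.
Context {R : realType} {I : finType} {i0 : I}.
Local Notation Sigma := (shift_space R i0).

(** The summand of the series in (3) for a candidate value [p], extended by zero to all words so
    that partial sums can be taken by length. *)
Definition weighted_fibre_word (psi f : Sigma -> R) (K p : R) (w : seq I) : R :=
  expR (word_sum f w - (size w)%:R * p) *
  ((0 < size w)%N && (`|word_sum psi w| <= K)%R)%:R.

Context {psi f : Sigma -> R} {D DB : R}.
Context (hD : distortion_constant psi D) (hDB : distortion_constant f DB).

Local Notation A := (word_sum psi).
Local Notation B := (word_sum f).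
Local Notation g s := (fun x : Sigma => s * psi x + f x).
Local Notation P := (fun s : R => pressure (g s)).
Local Notation E s := (potential_bound D DB s).

Let hP := pressure_word_family hD hDB.
Let qA := word_sum_quasi_additive hD.
Let qB := word_sum_quasi_additive hDB.

Definition fibre_sum (K : R) n : R :=
  wsum n (fun w => expR (B w) * (`|A w| <= K)%R%:R).

Lemma fibre_pressure_growth K : fibre_pressure_at f psi K = growth (fibre_sum K).
Proof.
rewrite /fibre_pressure_at /growth; congr limn_esup; apply/funext => n.
congr (_ * lne _%:E)%E; rewrite /fibre_sum /wsum big_mkcond/=.
by apply: eq_bigr => w _; case: ifP; rewrite ?mulr1 ?mulr0.
Qed.

(** On the words counted, inserting the factor exp(s A) costs at most exp(|s| K), uniformly in the
    length. *)
Lemma fibre_pressure_le K s : (fibre_pressure_at f psi K <= (P s)%:E)%E.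
Proof.
rewrite fibre_pressure_growth; apply: (@growth_le _ _ _ (`|s| * K + E s)) => n.
have /andP[_ h] := hP s n.
apply: (@le_trans _ _ (expR (`|s| * K) * expR (n%:R * P s + E s))); last first.
  by rewrite -expRD ler_expR; lra.
apply: le_trans (ler_wpM2l (expR_ge0 _) h).
rewrite /fibre_sum -wsumMl; apply: ler_wsum => w _.
case: (boolP (`|A w| <= K)) => AK; last by rewrite mulr0 mulr_ge0 ?expR_ge0.
rewrite mulr1 -expRD ler_expR /potential.
have : - (s * A w) <= `|s| * K.
  by apply: le_trans (ler_norm _) _; rewrite normrN normrM ler_wpM2l.
lra.
Qed.

Section zero_mean.
Context {K t C : R} {m : seq I -> R}.
Context (hK : D < K) (gm : gibbs_content (potential A B t) (P t) C m).
Context (mj : has_mean A D m 0).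

Let c : R := expR (C + `|t| * K).

Lemma gibbs_fibre_le w : m w * (`|A w| <= K)%R%:R <=
  c * (expR (B w - (size w)%:R * P t) * (`|A w| <= K)%R%:R).
Proof.
case: (boolP (`|A w| <= K)) => AK; last by rewrite !mulr0.
rewrite !mulr1 -expRD; have [_ /(_ w)/andP[_ /le_trans]] := gm; apply.
rewrite ler_expR /potential.
have : t * A w <= `|t| * K.
  by apply: le_trans (ler_norm _) _; rewrite normrM ler_wpM2l.
lra.
Qed.

Let recurrence := gibbs_recurrence i0 qA qB hP gm mj (word_sum_cat hD) hK.

Lemma fibre_words_divergence U : exists N,
  U < \sum_(n < N) wsum n (weighted_fibre_word psi f K (P t)).
Proof.
have c0 : 0 < c by exact: expR_gt0.
have [mc _] := gm; have [m1 m0 _ _] := mc.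
have [N hN] := recurrence (c * U + 1); exists N.
(* Recurrence counts the empty word, the series does not; the correction at [n = 0] is at most 1. *)
have term n : wsum n (fun w => m w * (`|A w| <= K)%R%:R) <=
    c * wsum n (weighted_fibre_word psi f K (P t)) + (n == 0%N)%:R.
  case: n => [|n].
    rewrite !wsum0 m1 mul1r /weighted_fibre_word/= mulr0 mulr0 add0r.
    by rewrite ler_nat leq_b1.
  rewrite addr0 -wsumMl; apply: ler_wsum => w wn.
  by apply: le_trans (gibbs_fibre_le w) _; rewrite /weighted_fibre_word wn.
have : \sum_(n < N) wsum n (fun w => m w * (`|A w| <= K)%R%:R) <=
    c * \sum_(n < N) wsum n (weighted_fibre_word psi f K (P t)) + 1.
  rewrite mulr_sumr; apply: (@le_trans _ _ (\sum_(n < N)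
    (c * wsum n (weighted_fibre_word psi f K (P t)) + (n == 0%N :> nat)%:R))).
    by apply: ler_sum => n _; exact: term.
  rewrite big_split/= lerD2l; case: N {hN} => [|N]; first by rewrite big_ord0.
  by rewrite big_ord_recl big1 ?addr0.
move=> /(lt_le_trans hN); rewrite ltrD2r ltr_pM2l//.
Qed.

(** A growth rate below [P t] would make the measures of the sets C_n(K) decay geometrically,
    against recurrence. *)
Lemma fibre_pressure_ge : ((P t)%:E <= fibre_pressure_at f psi K)%E.
Proof.
rewrite fibre_pressure_growth leNgt; apply/negP => /growth_lt[r rP [N0 hN0]].
have [mc _] := gm; have [m1 m0 _ _] := mc.
pose x n := wsum n (fun w => m w * (`|A w| <= K)%R%:R).
have x01 n : 0 <= x n <= 1.
  apply/andP; split; first by apply: wsum_ge0 => w _; rewrite mulr_ge0.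
  rewrite -(content_mass n mc); apply: ler_wsum => w _.
  by rewrite ler_piMr// lern1 leq_b1.
have xq n : (N0 <= n)%N -> x n <= c * expR (r - P t) ^+ n.
  move=> /hN0 h; apply: (@le_trans _ _ (c * (expR (- (n%:R * P t)) * fibre_sum K n))).
    rewrite -!wsumMl; apply: ler_wsum => w wn.
    apply: le_trans (gibbs_fibre_le w) _.
    by rewrite mulrA [X in _ <= _ * X]mulrA -expRD wn mulrA addrC.
  rewrite ler_pM2l ?expR_gt0//; apply: le_trans (ler_wpM2l (expR_ge0 _) h) _.
  by rewrite -expRD -expRM_natl ler_expR; lra.
have q1 : expR (r - P t) < 1 by rewrite expR_lt1; lra.
have [N] := recurrence (N0%:R + c / (1 - expR (r - P t))).
rewrite ltNge => /negP; apply.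
by apply: geometric_sum_bounded x01 xq N; rewrite ?expR_ge0.
Qed.

End zero_mean.

Lemma interior_fibre_pressure : holder_continuous psi ->
  (lower_mean psi < 0 < upper_mean psi)%E ->
  exists t : R,
    [/\ unique (fun s : R =>
          exists2 mu : probability (borel_shift_space R i0) R,
            is_gibbs_measure (g s) mu & (\int[mu]_x (psi x)%:E = 0)%E) t,
        forall s, P t <= P s &
        forall K, D < K -> fibre_pressure_at f psi K = (P t)%:E /\
          forall U, exists N, U < \sum_(n < N) wsum n (weighted_fibre_word psi f K (P t))].
Proof.
move=> hpsi /andP[lo up].
have gup := upper_mean_gt0 hD up; have glo := lower_mean_lt0 hD lo.
have [t tmin] := pressure_minimizer qA qB hP gup glo.
have [m [C [gm mj]]] := zero_mean_at_minimizer i0 qA qB hP tmin.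
exists t; split => //.
  split.
    have [mu mug mum] := gibbs_content_measure hD hDB gm; exists mu => //.
    have [inv _ _] := mug; have [j -> muj] := integral_has_mean hpsi hD inv.
    by rewrite mum in muj; rewrite (has_mean_unique muj mj).
  move=> s [nu [inv gb _] int0].
  have [C' gm'] := gibbs_property_content hD hDB inv gb.
  have [j jE nuj] := integral_has_mean hpsi hD inv.
  have j0 : j = 0 by apply: EFin_inj; rewrite -jE int0.
  rewrite j0 in nuj; apply/eqP/negPn/negP => ts.
  (* Used in both orders, this bounds [(t - s) * A] from both sides, while [A] grows linearly along
     some words. *)
  have [M1 hM1] := equal_means_bounded_below qA qB hP gm mj gm' nuj.
  have [M2 hM2] := equal_means_bounded_below qA qB hP gm' nuj gm mj.
  have [e e0 he] := gup.
  have ts0 : 0 < `|t - s| by rewrite normr_gt0 subr_eq0.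
  have : `|t - s| * e <= 0.
    apply: (@le0_frequently _ _ (Num.max (- M1) (- M2))) => N.
    have [w Nw Aw] := he N; exists (size w) => //.
    apply: (@le_trans _ _ (`|t - s| * A w)).
      by have := ler_wpM2l (ltW ts0) Aw; lra.
    rewrite le_max; have := hM1 w; have := hM2 w.
    by case: (ler0P (t - s)) => _ h2 h1; apply/orP; [left|right]; lra.
  by rewrite leNgt mulr_gt0.
move=> K hK; split; last by move=> U; exact: fibre_words_divergence hK gm mj U.
apply/eqP; rewrite eq_le fibre_pressure_le/=.
exact: fibre_pressure_ge hK gm mj.
Qed.

End fibre_pressure_bounds.

(** * Functions that are constant on one-cylinders *)

Section one_cylinder_functions.
Context {R : realType} {I : finType} {i0 : I}.
Local Notation Sigma := (shift_space R i0).

Definition letter_value (psi : Sigma -> R) (i : I) : R := psi (fun=> i).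

Context {psi : Sigma -> R} (hc : constant_on_one_cylinders psi).
Local Notation p := (letter_value psi).

Lemma one_cylinder_birkhoff n (x : Sigma) : birkhoff psi n x = \sum_(k < n) p (x k).
Proof.
by apply: eq_bigr => k _; apply: hc; rewrite iter_shiftE addn0.
Qed.

Lemma one_cylinder_distortion : distortion_constant psi 0.
Proof.
move=> w x y /cylinderP xw /cylinderP yw; rewrite !one_cylinder_birkhoff.
rewrite (eq_bigr (fun k : 'I_(size w) => p (y k))) ?subrr ?normr0// => k _.
by rewrite xw// yw.
Qed.

Lemma one_cylinder_word_sum w : word_sum psi w = \sum_(i <- w) p i.
Proof.
have := word_sum_bounds one_cylinder_distortion (cylinder_word_point w).
rewrite addr0 => h; have -> : word_sum psi w = birkhoff psi (size w) (word_point w).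
  by apply/eqP; rewrite eq_le andbC.
by rewrite one_cylinder_birkhoff (big_nth i0) big_mkord.
Qed.

Lemma mem_zero_letters i : (i \in zero_letters psi) = (p i == 0).
Proof.
rewrite inE; apply/asboolP/eqP => [/(_ (fun=> i))|pi x xi]; first exact.
by rewrite -pi; apply: hc; rewrite xi.
Qed.

Lemma lower_mean_ge (c : R) : (forall i, c <= p i) -> (c%:E <= lower_mean psi)%E.
Proof.
move=> cp; apply: le_ereal_inf_tmp => _ [x _ <-]; rewrite /limn_einf leeNr.
apply: limn_esup_le; near=> n.
have n0 : (0 : R) < n%:R by rewrite ltr0n; near: n; exact: nbhs_infty_gt.
rewrite leeN2 lee_fin ler_pdivlMr// one_cylinder_birkhoff mulrC mulr_natl.
rewrite -[n in X in X <= _]card_ord -sumr_const; apply: ler_sum => k _; exact: cp.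
Unshelve. all: by end_near. Qed.

Lemma upper_mean_le (c : R) : (forall i, p i <= c) -> (upper_mean psi <= c%:E)%E.
Proof.
move=> cp; apply: ge_ereal_sup => _ [x _ <-].
apply: limn_esup_le; near=> n.
have n0 : (0 : R) < n%:R by rewrite ltr0n; near: n; exact: nbhs_infty_gt.
rewrite lee_fin ler_pdivrMr// one_cylinder_birkhoff mulrC mulr_natl.
rewrite -[n in X in _ <= X]card_ord -sumr_const; apply: ler_sum => k _; exact: cp.
Unshelve. all: by end_near. Qed.

Lemma const_mean i n : (0 < n)%N -> birkhoff psi n (fun=> i) / n%:R = p i.
Proof.
move=> n0; rewrite one_cylinder_birkhoff sumr_const card_ord -[p i *+ n]mulr_natr mulfK//.
by rewrite pnatr_eq0 -lt0n.
Qed.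

Lemma lower_mean_le i : (lower_mean psi <= (p i)%:E)%E.
Proof.
apply: (@le_trans _ _ (limn_einf (fun n => (birkhoff psi n (fun=> i) / n%:R)%:E))).
  by apply: ereal_inf_lbound; exists (fun=> i).
apply: le_trans (limn_einf_sup _) _; apply: limn_esup_le; near=> n.
by rewrite const_mean//; near: n; exact: nbhs_infty_gt.
Unshelve. all: by end_near. Qed.

Lemma upper_mean_ge i : ((p i)%:E <= upper_mean psi)%E.
Proof.
apply: (@le_trans _ _ (limn_esup (fun n => (birkhoff psi n (fun=> i) / n%:R)%:E))).
  apply: limn_esup_ge => N; exists N.+1 => //.
  by rewrite const_mean.
by apply: ereal_sup_ubound; exists (fun=> i).
Qed.

(** Birkhoff averages are averages of letter values, and the constant sequence at a minimizing
    letter attains the minimum. *)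
Lemma lower_meanE : exists2 i, lower_mean psi = (p i)%:E & forall j, p i <= p j.
Proof.
have [i _ imin] := @Order.TotalTheory.arg_minP _ _ I i0 xpredT p isT.
exists i => [|j]; last exact: imin.
by apply/eqP; rewrite eq_le lower_mean_le lower_mean_ge// => j; exact: imin.
Qed.

Lemma upper_meanE : exists2 i, upper_mean psi = (p i)%:E & forall j, p j <= p i.
Proof.
have [i _ imax] := @Order.TotalTheory.arg_maxP _ _ I i0 xpredT p isT.
exists i => [|j]; last exact: imax.
by apply/eqP; rewrite eq_le upper_mean_ge upper_mean_le// => j; exact: imax.
Qed.

End one_cylinder_functions.

Section degenerate_cases.
Context {R : realType} {I : finType} {i0 : I}.
Local Notation Sigma := (shift_space R i0).
Context {psi f : Sigma -> R} (hc : constant_on_one_cylinders psi).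
Context {DB : R} (hDB : distortion_constant f DB) {K : R} (K0 : 0 < K).

Local Notation A := (word_sum psi).
Local Notation B := (word_sum f).
Local Notation p := (letter_value psi).
Local Notation g s := (fun x : Sigma => s * psi x + f x).
Local Notation P s := (pressure (g s)).

Let hD := one_cylinder_distortion hc.
Let hP := pressure_word_family hD hDB.
Let AE := one_cylinder_word_sum hc.

(** Because [psi] has distortion 0 the error does not depend on [s], so [s] can go to infinity at a
    fixed length [n]. *)
Lemma pressure_bounds s n :
  expR (n%:R * P s - DB) <= wsum n (fun w => expR (potential A B s w))
    <= expR (n%:R * P s + DB).
Proof. by have := hP s n; rewrite /potential_bound mulr0 add0r. Qed.

Lemma inf_pressure_ge :
  (fibre_pressure_at f psi K <= ereal_inf (range (fun s => (P s)%:E)))%E.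
Proof. by apply: le_ereal_inf_tmp => _ [s _ <-]; exact: (fibre_pressure_le hD hDB). Qed.

(** * Letter values bounded away from 0 on one side, the sign [e] telling which *)

Section nonzero_mean.
Context {e d : R} (e1 : `|e| = 1) (d0 : 0 < d) (hd : forall i, d <= e * p i).

Lemma drift_word_sum w : (size w)%:R * d <= e * A w.
Proof.
rewrite AE mulr_sumr; elim: w => [|i w IH]; first by rewrite big_nil mul0r.
rewrite big_cons /= -[(size w).+1%:R]natr1; have := hd i; move: IH; lra.
Qed.

Lemma drift_fibre_pressure : fibre_pressure_at f psi K = -oo%E.
Proof.
rewrite fibre_pressure_growth; apply: (@growth_Ny _ _ (Num.bound (K / d))) => n nK.
rewrite /fibre_sum (@eq_wsum _ _ _ _ (fun=> 0 * 0)) => [|w wn].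
  by rewrite wsumMl mul0r.
rewrite mulr0; case: (boolP (`|A w| <= K)) => AK; last by rewrite mulr0.
have := drift_word_sum w; rewrite wn.
have : e * A w <= K by apply: le_trans (ler_norm _) _; rewrite normrM e1 mul1r.
have : K / d < n%:R.
  have Kd : 0 <= K / d by apply: divr_ge0; exact: ltW.
  by apply: lt_le_trans (archi_boundP Kd) _; rewrite ler_nat.
rewrite ltr_pdivrMr//; lra.
Qed.

(** Moving [s] against the drift by [tau] lowers every exponent by at least [tau * d] per letter. *)
Lemma drift_inf_pressure : ereal_inf (range (fun s => (P s)%:E)) = -oo%E.
Proof.
have Pd tau : 0 <= tau -> P (- (tau * e)) <= P 0 - tau * d.
  move=> tau0; rewrite -subr_le0; apply: (@le0_archi _ _ (DB + DB)) => n.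
  have /andP[h1 _] := pressure_bounds (- (tau * e)) n.
  have /andP[_ h2] := pressure_bounds 0 n.
  move: (P (- (tau * e))) (P 0) h1 h2 => P1 P0 h1 h2.
  suff : expR (n%:R * P1 - DB) <= expR (- (n%:R * (tau * d)) + (n%:R * P0 + DB)).
    by rewrite ler_expR; lra.
  apply: (le_trans h1); rewrite [leRHS]expRD.
  apply: le_trans (ler_wpM2l (expR_ge0 _) h2); rewrite -wsumMl.
  apply: ler_wsum => w wn; rewrite -expRD ler_expR /potential.
  by have := ler_wpM2l tau0 (drift_word_sum w); rewrite wn; lra.
suff inf_le M : (ereal_inf (range (fun s => (P s)%:E)) <= M%:E)%E.
  case: (ereal_inf _) inf_le => [r h|h|//].
    by exfalso; have := h (r - 1); rewrite lee_fin; lra.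
  by have := h 0; rewrite leye_eq.
pose tau := Num.max 0 ((P 0 - M) / d).
apply: (@le_trans _ _ (P (- (tau * e)))%:E).
  by apply: ereal_inf_lbound; exists (- (tau * e)).
have tau0 : 0 <= tau by rewrite le_max lexx.
rewrite lee_fin; apply: le_trans (Pd _ tau0) _.
have : (P 0 - M) / d <= tau by rewrite le_max lexx orbT.
by rewrite ler_pdivrMr//; lra.
Qed.

End nonzero_mean.

(** * Extremal mean 0: reduction to the alphabet of zero letters *)

Section zero_extremal_mean.
Context {e : R} (e_neq0 : e != 0) (he : forall i, 0 <= e * p i) {j0 : I} (hj0 : p j0 = 0).

Local Notation J := (zero_letters psi).
Let ZJ n := wsum n (fun w => expR (B w) * (all (mem J) w)%:R).

Lemma zero_word_sum w : all (mem J) w -> A w = 0.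
Proof.
move=> /allP wJ; rewrite AE big1_seq// => i /andP[_ /wJ].
by rewrite /= (mem_zero_letters hc) => /eqP.
Qed.

Lemma zero_partition_gt0 n : 0 < ZJ n.
Proof.
apply: (@lt_le_trans _ _ (expR (B (nseq n j0)))); first exact: expR_gt0.
have := @ler_wsum_term _ _ n (fun w => expR (B w) * (all (mem J) w)%:R) (nseq n j0).
rewrite size_nseq all_nseq /= (mem_zero_letters hc) hj0 eqxx orbT mulr1.
by apply => // w _; rewrite mulr_ge0 ?expR_ge0.
Qed.

(** The restriction to words over [J] is multiplicative under concatenation, so the restricted
    partition functions are again quasi-multiplicative with constant [DB]. *)
Lemma zero_pressure_bounds n :
  expR (n%:R * pressure_on f J - DB) <= ZJ n <=
  expR (n%:R * pressure_on f J + DB).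
Proof.
have ZE k : ZJ k = expR (ln (ZJ k)) by rewrite lnK// posrE zero_partition_gt0.
have [a k|P0 hP0] := @quasi_additive_limit _ (fun n => ln (ZJ n)) DB.
  have : expR (ln (ZJ a) + ln (ZJ k) - DB) <= expR (ln (ZJ (a + k)%N))
           <= expR (ln (ZJ a) + ln (ZJ k) + DB).
    rewrite !expRD -!ZE {1 5}/ZJ [ZJ (a + k)%N]wsumD -!wsumMr.
    have qa u v : `|B (u ++ v) - B u - B v| <= DB.
      exact: word_sum_quasi_additive hDB u v.
    apply/andP; split; apply: ler_wsum => u _; rewrite mulrAC /ZJ -wsumMl;
      apply: ler_wsum => v _; rewrite all_cat; have := qa u v;
      case: (all _ u) => /=; rewrite ?mulr0 ?mul0r ?mulr0//;
      case: (all _ v); rewrite /= ?mulr0 ?mulr1 -?expRD ?ler_expR ?ler_norml//; lra.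
  by rewrite !ler_expR ler_norml; lra.
have -> : pressure_on f J = P0 by exact: pressure_onE hP0.
by rewrite ZE !ler_expR; have := hP0 n; rewrite ler_norml; lra.
Qed.

Lemma zero_pressure_le : ((pressure_on f J)%:E <= fibre_pressure_at f psi K)%E.
Proof.
rewrite fibre_pressure_growth; apply: (@growth_ge _ _ _ DB) => n.
have /andP[+ _] := zero_pressure_bounds n; move=> /le_trans; apply.
apply: ler_wsum => w _; rewrite ler_wpM2l ?expR_ge0// ler_nat.
case: (boolP (all _ w)) => //= wJ.
by rewrite (zero_word_sum wJ) normr0 ltW.
Qed.

Lemma zero_pressure_divergence U : exists N,
  U < \sum_(n < N) wsum n (weighted_fibre_word psi f K (pressure_on f J)).
Proof.
have term n : expR (- DB) <=
    wsum n.+1 (weighted_fibre_word psi f K (pressure_on f J)).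
  have /andP[+ _] := zero_pressure_bounds n.+1.
  move=> /(ler_wpM2l (expR_ge0 (- (n.+1%:R * pressure_on f J)))).
  rewrite -expRD => h; apply: le_trans (le_trans h _).
    by rewrite ler_expR; lra.
  rewrite -wsumMl; apply: ler_wsum => w wn; rewrite /weighted_fibre_word wn.
  rewrite mulrA -expRD addrC ler_wpM2l ?expR_ge0// ler_nat/=.
  case: (boolP (all _ w)) => //= wJ.
  by rewrite (zero_word_sum wJ) normr0 ltW.
exists (Num.bound (`|U| / expR (- DB))).+1.
rewrite big_ord_recl/=; set N := Num.bound _.
have w0 : 0 <= wsum 0 (weighted_fibre_word psi f K (pressure_on f J)).
  by apply: wsum_ge0 => w _; rewrite mulr_ge0 ?expR_ge0.
have : \sum_(n < N) expR (- DB) <=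
    \sum_(n < N) wsum (bump 0 n)
      (weighted_fibre_word psi f K (pressure_on f J)).
  by apply: ler_sum => n _; exact: term.
rewrite sumr_const card_ord -mulr_natl.
have : `|U| / expR (- DB) < N%:R.
  by apply: archi_boundP; rewrite divr_ge0 ?expR_ge0.
rewrite ltr_pdivrMr ?expR_gt0//; have := ler_norm U; lra.
Qed.

(** The alphabet is finite, so the nonzero values [e * p i] have a positive minimum, and one such
    letter suffices as the others contribute nonnegatively. The default 1 covers the case without
    such letters. *)
Lemma gap : exists2 d : R, 0 < d &
  forall w, ~~ all (mem J) w -> d <= e * A w.
Proof.
pose d := \big[Num.min/1]_(i | p i != 0) (e * p i).
have d_le i : p i != 0 -> d <= e * p i.
  by move=> pi; exact: (Order.TotalTheory.bigmin_le_cond _ (fun i => e * p i)).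
exists d.
  apply: Order.POrderTheory.lt_bigmin => // i pi.
  by rewrite lt_neqAle he andbT eq_sym mulf_neq0.
move=> w; rewrite AE mulr_sumr; elim: w => [//|i w IH] /=.
rewrite big_cons negb_and => /orP[|/IH h]; last by have := he i; lra.
rewrite (mem_zero_letters hc) => /d_le h.
have : 0 <= \sum_(j <- w) e * p j by rewrite sumr_ge0.
lra.
Qed.

Lemma inf_pressure_le :
  (ereal_inf (range (fun s => (P s)%:E)) <= (pressure_on f J)%:E)%E.
Proof.
have [d d0 hd] := gap.
apply/lee_addgt0Pr => r r0; rewrite -EFinD.
(* The final estimate is P(s) <= p + (2 DB + 1) / n, with p the pressure on [J]: [DB] enters from
   both partition functions, and 1 from 2 <= exp 1. *)
pose n := (Num.bound ((2 * DB + 1) / r)).+1.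
have DB0 : 0 <= DB by exact: distortion_ge0 hDB.
have nr : (2 * DB + 1) / r <= n%:R.
  apply: le_trans (ltW (archi_boundP _)) _; last by rewrite ler_nat.
  by rewrite divr_ge0 ?ltW//; lra.
pose Y := wsum n (fun w => expR (potential A B 0 w)).
have Y0 : 0 < Y by exact: partition_gt0.
(* So large that at s = - tau e the words leaving [J] together weigh at most [ZJ n], by the gap
   [d]. *)
pose tau := `|ln (Y / ZJ n)| / d.
have tau0 : 0 <= tau by rewrite divr_ge0// ltW.
apply: (@le_trans _ _ (P (- (tau * e)))%:E).
  by apply: ereal_inf_lbound; exists (- (tau * e)).
have Zn := zero_partition_gt0 n.
have tail : expR (- (tau * d)) * Y <= ZJ n.
  rewrite /tau divfK ?gt_eqF// -ler_pdivlMl ?expR_gt0// expRN invrK.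
  rewrite -ler_pdivrMr// -{1}(@lnK _ (Y / ZJ n)) ?posrE ?divr_gt0//.
  by rewrite ler_expR ler_norm.
have Z2 : wsum n (fun w => expR (potential A B (- (tau * e)) w)) <= 2 * ZJ n.
  apply: (@le_trans _ _ (ZJ n + expR (- (tau * d)) * Y)); last lra.
  rewrite -wsumMl -wsum_add; apply: ler_wsum => w _.
  case: (boolP (all _ w)) => wJ.
    rewrite mulr1 /potential (zero_word_sum wJ) mulr0 add0r lerDl.
    by rewrite mulr_ge0 ?expR_ge0.
  rewrite mulr0 add0r -expRD ler_expR /potential.
  by have := ler_wpM2l tau0 (hd _ wJ); lra.
have /andP[h1 _] := pressure_bounds (- (tau * e)) n.
have /andP[_ h2] := zero_pressure_bounds n.
rewrite lee_fin.
have : expR (n%:R * P (- (tau * e)) - DB) <=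
    expR (1 + (n%:R * pressure_on f J + DB)).
  apply: (le_trans h1); apply: (le_trans Z2); rewrite expRD ler_pM//.
    exact: ltW.
  by have := expR_ge1Dx (1 : R); lra.
rewrite ler_expR => h.
have n0 : 0 < n%:R :> R by rewrite ltr0n.
rewrite -(ler_pM2l n0); move: nr; rewrite ler_pdivrMr//; lra.
Qed.

Lemma zero_mean_fibre_pressure :
  fibre_pressure_at f psi K = (pressure_on f J)%:E /\
  ereal_inf (range (fun s => (P s)%:E)) = (pressure_on f J)%:E.
Proof.
have h1 := zero_pressure_le; have h2 := inf_pressure_ge; have h3 := inf_pressure_le.
split; apply/eqP; rewrite eq_le ?h1 ?h3 ?(le_trans h2 h3) ?(le_trans h1 h2)//.
Qed.

End zero_extremal_mean.
End degenerate_cases.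

Section conclusion.
Context {R : realType} {I : finType} {i0 : I}.
Local Notation Sigma := (shift_space R i0).
Implicit Types psi f : Sigma -> R.

Lemma fibre_esum_infty psi f (K p : R) : fibre_pressure_at f psi K = p%:E ->
  (forall U, exists N,
    U < \sum_(n < N) wsum n (weighted_fibre_word psi f K p)) ->
  (\esum_(w in fibre_words psi K)
     expeR ((word_sum f w)%:E
            - (size w)%:R%:E * fibre_pressure_at f psi K) = +oo)%E.
Proof.
move=> ->; apply: esum_words_infty => w.
  move=> [w0 wK]; rewrite /weighted_fibre_word w0 wK mulr1.
  by rewrite -EFinM -EFinB.
move=> nS; rewrite /weighted_fibre_word.
case: (boolP (_ && _)) => [/andP[w0 wK]|]; last by rewrite mulr0.
by exfalso; apply: nS.
Qed.

Lemma fibre_pressure_eventually psi f (v : \bar R) :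
  (forall K, 0 < K -> fibre_pressure_at f psi K = v) -> fibre_pressure f psi = v.
Proof.
move=> h; apply: lim_near_cst => //; near=> K; apply: h.
by near: K; exact: nbhs_pinfty_gt.
Unshelve. all: by end_near. Qed.

Variant mean_cases psi : Prop :=
| MeanInterior of (lower_mean psi < 0 < upper_mean psi)%E
| MeanZero (e : R) (j : I) of e != 0 & (forall i, 0 <= e * letter_value psi i) &
    letter_value psi j = 0 & (lower_mean psi <= 0 <= upper_mean psi)%E
| MeanNonzero (e d : R) of `|e| = 1 & 0 < d &
    (forall i, d <= e * letter_value psi i) &
    ~~ (lower_mean psi <= 0 <= upper_mean psi)%E.

Lemma mean_casesP psi : constant_on_one_cylinders psi -> mean_cases psi.
Proof.
move=> hc; have [i li imin] := lower_meanE hc; have [j uj jmax] := upper_meanE hc.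
have ij := imin j.
have [i_lt0|i_gt0|i0'] := ltgtP (letter_value psi i) 0; last 1 first.
- apply: (@MeanZero _ 1 i); [exact: oner_neq0|move=> k| |] => //.
    by rewrite mul1r -i0'.
  by rewrite li uj !lee_fin i0' lexx -i0'.
- have [j_lt0|j_gt0|j0'] := ltgtP (letter_value psi j) 0.
  + apply: (@MeanNonzero _ (-1) (- letter_value psi j)).
    * by rewrite normrN1.
    * by rewrite oppr_gt0.
    * by move=> k; rewrite mulN1r lerN2.
    * by rewrite negb_and uj -!ltNge lte_fin j_lt0 orbT.
  + by apply: MeanInterior; rewrite li uj !lte_fin i_lt0.
  + apply: (@MeanZero _ (-1) j); [|move=> k| |] => //.
      by rewrite mulN1r oppr_ge0 -j0'.
    by rewrite li uj !lee_fin j0' lexx ltW.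
- apply: (@MeanNonzero _ 1 (letter_value psi i)); [exact: normr1| |move=> k|] => //.
    by rewrite mul1r.
  by rewrite negb_and li -!ltNge lte_fin i_gt0.
Qed.

End conclusion.

Theorem theorem3p1 (R : realType) (I : finType) (i0 : I)
    (psi f : shift_space R i0 -> R) (D K : R)
    (hpsi : holder_continuous psi) (hf : holder_continuous f)
    (hD : distortion_constant psi D) (hK : D < K) :
  ((lower_mean psi < 0 < upper_mean psi)%E ->
    exists t : R,
      [/\ unique (fun s : R =>
            exists2 mu : probability (borel_shift_space R i0) R,
              is_gibbs_measure (fun x => s * psi x + f x) mu &
              (\int[mu]_x (psi x)%:E = 0)%E) t,
          fibre_pressure_at f psi K
            = (pressure (fun x => t * psi x + f x))%:E &
          forall s : R, pressure (fun x => t * psi x + f x)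
                        <= pressure (fun x => s * psi x + f x)])
  /\
  (constant_on_one_cylinders psi ->
    [/\ fibre_pressure_at f psi K
          = ereal_inf (range (fun s : R =>
              (pressure (fun x => s * psi x + f x))%:E)),
        fibre_pressure f psi \is a fin_num
          <-> (lower_mean psi <= 0 <= upper_mean psi)%E &
        (lower_mean psi = 0%E \/ upper_mean psi = 0%E) ->
        fibre_pressure_at f psi K
          = (pressure_on f (zero_letters psi))%:E])
  /\
  ((lower_mean psi < 0 < upper_mean psi)%E \/
   (constant_on_one_cylinders psi /\
    (lower_mean psi <= 0 <= upper_mean psi)%E) ->
    (\esum_(w in fibre_words psi K)
       expeR ((word_sum f w)%:E
              - (size w)%:R%:E * fibre_pressure_at f psi K) = +oo)%E).
Proof.
have [DB hDB] := holder_distortion hf.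
have K0 : 0 < K by exact: le_lt_trans (distortion_ge0 hD) hK.
split; [|split].
- move=> h; have [t [tu tmin tK]] := interior_fibre_pressure hD hDB hpsi h.
  by exists t; split => //; have [] := tK K hK.
(* With distortion constant 0 every positive [K] is admissible, so the value does not depend on [K]
   and is also that of the limit [fibre_pressure]. *)
- move=> hc; have hD0 := one_cylinder_distortion hc.
  case: (mean_casesP hc) => [h|e j e0 he hj h|e d e1 d0 hd h].
  + have [t [_ tmin tK]] := interior_fibre_pressure hD0 hDB hpsi h.
    have /andP[lo up] := h.
    have tK' K' (K'0 : 0 < K') := (tK K' K'0).1.
    split.
    * rewrite tK'//; apply/eqP; rewrite eq_le; apply/andP; split.
        by apply: le_ereal_inf_tmp => _ [s _ <-]; rewrite lee_fin.
      by apply: ereal_inf_lbound; exists t.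
    * by rewrite (fibre_pressure_eventually tK') (ltW lo) (ltW up).
    * by move=> [l0|u0]; [rewrite l0 ltxx in lo|rewrite u0 ltxx in up].
  + have zK K' (K'0 : 0 < K') := zero_mean_fibre_pressure hc hDB K'0 e0 he hj.
    have [zK1 zK2] := zK K K0; split.
    * by rewrite zK1 zK2.
    * by rewrite (fibre_pressure_eventually (fun K' K'0 => (zK K' K'0).1)) h.
    * by move=> _.
  + have dK K' (K'0 : 0 < K') := drift_fibre_pressure (f := f) hc K'0 e1 d0 hd.
    have dinf := drift_inf_pressure hc hDB d0 hd.
    split.
    * by rewrite dK// dinf.
    * by rewrite (fibre_pressure_eventually dK); split => //; rewrite (negbTE h).
    (* If one of the means were 0, the order of the means would put 0 between them, contrary to
       [h]. *)
    * have lu := lower_le_upper_mean (psi := psi).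
      by move=> [l0|u0]; move/negP : h => []; rewrite ?l0 ?u0 ?lexx ?andbT//;
        [rewrite -l0|rewrite -u0].
- move=> [h|[hc h]].
    have [t [_ _ tK]] := interior_fibre_pressure hD hDB hpsi h.
    by have [tE tdiv] := tK K hK; exact: fibre_esum_infty tE tdiv.
  case: (mean_casesP hc) => [h'|e j e0 he hj _|e d _ _ _].
  + have [t [_ _ tK]] := interior_fibre_pressure hD hDB hpsi h'.
    by have [tE tdiv] := tK K hK; exact: fibre_esum_infty tE tdiv.
  + have [zE _] := zero_mean_fibre_pressure hc hDB K0 e0 he hj.
    apply: (fibre_esum_infty zE).
    by move=> U; apply: (zero_pressure_divergence hc hDB K0 hj).
  + by rewrite h.
Qed.
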